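(* Given a matrix $A\in\mathbb{R}^{n\times d}$ and an integer $k\geq 1$, there exists an algorithm that takes $\mathrm{poly}(n)\cdot d^{\widetilde{O}(k)}\cdot 2^{\widetilde{O}(k^2)}$ time and outputs two matrices $U\in\mathbb{R}^{n\times k}$, $V\in\mathbb{R}^{k\times d}$ such that, with probability $9/10$, $$\|UV-A\|_1\leq \widetilde{O}(k)\min_{\mathrm{rank}\text{-}k\ A_k}\|A_k-A\|_1.$$
   Context: $\|C\|_1=\sum_{i,j}|C_{i,j}|$ is the entrywise $\ell_1$ norm; $\widetilde{O}(f)=f\cdot\log^{O(1)}(f)$. The minimum is over all $n\times d$ matrices of rank at most $k$. *)

(* Defs.v *)
From HB Require Import structures.
From mathcomp Require Import all_boot all_order all_algebra.
From mathcomp Require Import all_classical all_reals all_analysis.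

Set Implicit Arguments.
Unset Strict Implicit.
Unset Printing Implicit Defensive.

Import Order.TTheory GRing.Theory Num.Theory.
Local Open Scope ring_scope.

(** A randomized real RAM: integer and real registers (named statically by the
    program), integer and real memories (reached only through an address held
    in an integer register), unit-cost exact real arithmetic and comparisons,
    and fair coin flips.  To rule out the known abuses of unit-cost models, a
    program contains no real constant other than natural numbers, there is no
    rounding and no conversion from reals to integers, and integers are only
    added, subtracted and compared. *)

Inductive instr : Type :=
| IConst of nat & nat          (* i[x] := c *)
| IAdd of nat & nat & nat      (* i[x] := i[y] + i[z] *)
| ISub of nat & nat & nat      (* i[x] := i[y] - i[z], truncated at 0 *)
| ILoad of nat & nat           (* i[x] := IM[i[y]] *)
| IStore of nat & nat          (* IM[i[x]] := i[y] *)
| IJle of nat & nat & nat      (* if i[x] <= i[y] then goto l *)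
| FConst of nat & nat          (* f[x] := c *)
| FAdd of nat & nat & nat      (* f[x] := f[y] + f[z] *)
| FSub of nat & nat & nat      (* f[x] := f[y] - f[z] *)
| FMul of nat & nat & nat      (* f[x] := f[y] * f[z] *)
| FDiv of nat & nat & nat      (* f[x] := f[y] / f[z], which is 0 if f[z] = 0 *)
| FLoad of nat & nat           (* f[x] := FM[i[y]] *)
| FStore of nat & nat          (* FM[i[x]] := f[y] *)
| FJle of nat & nat & nat      (* if f[x] <= f[y] then goto l *)
| Coin of nat.                 (* i[x] := next coin flip, 0 or 1 *)

Definition program := seq instr.

Definition upd (T : Type) (m : nat -> T) (x : nat) (v : T) : nat -> T :=
  fun y => if y == x then v else m y.

Section RealRAM.
Variable R : realType.

Record config := Config {
  pc : nat;
  ireg : nat -> nat;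
  imem : nat -> nat;
  freg : nat -> R;
  fmem : nat -> R;
  ncoins : nat  (* coins flipped so far *)
}.

Definition set_ireg (c : config) x v :=
  Config (pc c).+1 (upd (ireg c) x v) (imem c) (freg c) (fmem c) (ncoins c).
Definition set_imem (c : config) x v :=
  Config (pc c).+1 (ireg c) (upd (imem c) x v) (freg c) (fmem c) (ncoins c).
Definition set_freg (c : config) x v :=
  Config (pc c).+1 (ireg c) (imem c) (upd (freg c) x v) (fmem c) (ncoins c).
Definition set_fmem (c : config) x v :=
  Config (pc c).+1 (ireg c) (imem c) (freg c) (upd (fmem c) x v) (ncoins c).
Definition set_pc (c : config) l :=
  Config l (ireg c) (imem c) (freg c) (fmem c) (ncoins c).

Definition exec_instr (w : nat -> bool) (c : config) (ins : instr) : config :=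
  match ins with
  | IConst x v => set_ireg c x v
  | IAdd x y z => set_ireg c x (ireg c y + ireg c z)%N
  | ISub x y z => set_ireg c x (ireg c y - ireg c z)%N
  | ILoad x y => set_ireg c x (imem c (ireg c y))
  | IStore x y => set_imem c (ireg c x) (ireg c y)
  | IJle x y l => set_pc c (if (ireg c x <= ireg c y)%N then l else (pc c).+1)
  | FConst x v => set_freg c x v%:R
  | FAdd x y z => set_freg c x (freg c y + freg c z)
  | FSub x y z => set_freg c x (freg c y - freg c z)
  | FMul x y z => set_freg c x (freg c y * freg c z)
  | FDiv x y z => set_freg c x (freg c y / freg c z)
  | FLoad x y => set_freg c x (fmem c (ireg c y))
  | FStore x y => set_fmem c (ireg c x) (freg c y)
  | FJle x y l => set_pc c (if freg c x <= freg c y then l else (pc c).+1)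
  | Coin x => Config (pc c).+1 (upd (ireg c) x (nat_of_bool (w (ncoins c))))
                (imem c) (freg c) (fmem c) (ncoins c).+1
  end.

Definition halted (P : program) (c : config) : bool := (size P <= pc c)%N.

Definition step (P : program) (w : nat -> bool) (c : config) : config :=
  if halted P c then c else exec_instr w c (nth (IConst 0 0) P (pc c)).

Definition run (P : program) (w : nat -> bool) (t : nat) (c : config) : config :=
  iter t (step P w) c.

(** Row-major storage of an m x p matrix in the cells o, o+1, ..., o+mp-1. *)
Definition read_mx (mem : nat -> R) (o m p : nat) : 'M[R]_(m, p) :=
  \matrix_(i < m, j < p) mem (o + (i * p + j))%N.

Definition write_mx (m p : nat) (A : 'M[R]_(m, p)) : nat -> R :=
  fun a => \sum_(i < m) \sum_(j < p | a == (i * p + j)%N) A i j.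

(** n, d, k in the first three integer registers, A in the real memory, and 0
    everywhere else. *)
Definition init (n d : nat) (A : 'M[R]_(n, d)) (k : nat) : config :=
  Config 0 (nth 0%N [:: n; d; k]) (fun=> 0%N) (fun=> 0) (write_mx A) 0.

(** The output is U followed by V in the real memory. *)
Definition outU (n k : nat) (c : config) : 'M[R]_(n, k) :=
  read_mx (fmem c) 0 n k.
Definition outV (n k d : nat) (c : config) : 'M[R]_(k, d) :=
  read_mx (fmem c) (n * k) k d.

(** The probability of E over t fair coins; meaningful for events that depend
    only on the first t coins, such as the result of a run of at most t steps. *)
Definition coin_prob (t : nat) (E : (nat -> bool) -> Prop) : R :=
  #|[pred s : t.-tuple bool | `[< E (nth false s) >]]|%:R / 2 ^+ t.

Definition l1norm (m p : nat) (C : 'M[R]_(m, p)) : R :=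
  \sum_(i < m) \sum_(j < p) `|C i j|.

(** The infimum is attained, the set of matrices of rank at most k being
    closed. *)
Definition min_rank_err (n d : nat) (A : 'M[R]_(n, d)) (k : nat) : R :=
  inf [set l1norm (Ak - A) | Ak in [set B : 'M[R]_(n, d) | (\rank B <= k)%N]]%classic.

(** g = f * log^O(1) f, uniformly over k >= 1; the shift by 2 keeps the
    logarithm away from 0 when f k = 1. *)
Definition softO (g f : nat -> R) : Prop :=
  exists (C : R) (c : nat), forall k : nat, (1 <= k)%N ->
    g k <= C * f k * ln (f k + 2) ^+ c.

End RealRAM.

(* Main.v *)
Require Import Defs.
From HB Require Import structures.
From mathcomp Require Import all_boot all_order all_algebra.
From mathcomp Require Import all_classical all_reals all_analysis.
From mathcomp Require Import zify ring lra.

(** The algorithm is deterministic.  For every matrix [B] of rank at most [k]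
    there are [k] columns of [A] whose span approximates [A] within a factor
    [k + 1] of [|B - A|]: write [B = U V], and choose the columns [S] maximising
    [|det V_S|] divided by the product of the errors of the columns in [S]; by
    Cramer's rule the coefficients of [V] over [V_S] are then small enough.  So
    it suffices to run through the [d ^ k] choices of [k] columns, and to solve
    an l1 regression problem on their span within a factor 4 for every column
    of [A].

    The regression is done without linear programming.  Gaussian elimination
    with pivoting gives a residual at most [(1 + n) ^ k] times the optimum.
    Given a basis [q] of the span such that [|x_l| |q_l| <= 5 ^ k |sum x q|], a
    residual exceeding 4 times the optimum is halved by trying all points of a
    grid with [2 ^ O(k)] values per coordinate, at a scale read off the
    residual; [n k] rounds are enough.  Such a basis is obtained by an
    l1 version of Gram-Schmidt: each new vector is replaced by its own
    factor-4 residual with respect to the previous ones. *)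

Set Implicit Arguments.
Unset Strict Implicit.
Unset Printing Implicit Defensive.

Import Order.TTheory GRing.Theory Num.Theory.
Local Open Scope ring_scope.

(** * A structured language and its compilation to the real RAM *)

(** The running time may depend on [n], [d] and [k] only, never on the real entries, so the number
    of rounds of the regression has to be fixed in advance. That is the purpose of elimination: its
    residual is within [(1 + n) ^ k <= 2 ^ (n k)] of the optimum for every matrix, so [n k] halvings
    suffice. A halving works because the span contains a point within a quarter of the residual, and
    rounding its [k] coordinates costs another quarter in total; the factor 4 of the regression
    comes from here. Rounding is affordable only if the coordinates of that point are bounded, which
    the eliminated vectors do not guarantee. Hence two bases of the same span are kept, one with
    pivots and one well conditioned; the second is built by the same regression over its own
    predecessors. Time is counted crudely: every loop is charged the largest loop limit. This raises
    the bound to the power of the nesting depth, a constant of the program, and a constant power of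
    [d ^ k] or of [2 ^ O(k^2)] still has the required form. *)

(** [Ld x m y] is [f[x] := a_m[i[y]]], [St m y x] is [a_m[i[y]] := f[x]] and
    [Wr x y] is [FM[i[x]] := f[y]].  The entry [j] of the array [a_m], [m < 8],
    lives at the address [i[5] + 8 j + m]: the arrays are interleaved, and with
    [i[5] = n d] they leave the input in place.  [For x y c] runs [c] for
    [i[x] = 0, ..., i[y] - 1].  The registers [i[3]] and [i[4]] are scratch. *)
Inductive com : Type :=
| Reg of instr
| Ld of nat & nat & nat
| St of nat & nat & nat
| Wr of nat & nat
| Seq of com & com
| For of nat & nat & com
| IfI of nat & nat & com & com
| IfF of nat & nat & com & com.

Notation "c1 ;; c2" := (Seq c1 c2) (at level 60, right associativity).

Definition Skip := Reg (IConst 4 0).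

Definition array_addr (m y : nat) : seq instr :=
  [:: IAdd 3 y y; IAdd 3 3 3; IAdd 3 3 3; IConst 4 m; IAdd 3 3 4; IAdd 3 3 5].

Definition blk (c : com) : seq instr :=
  match c with
  | Reg i => [:: i]
  | Ld x m y => rcons (array_addr m y) (FLoad x 3)
  | St m y x => rcons (array_addr m y) (FStore 3 x)
  | Wr x y => [:: FStore x y]
  | _ => [::]
  end.

Fixpoint csize (c : com) : nat :=
  match c with
  | Seq c1 c2 => csize c1 + csize c2
  | For _ _ c => csize c + 5
  | IfI _ _ c1 c2 | IfF _ _ c1 c2 => csize c1 + csize c2 + 2
  | _ => size (blk c)
  end.

(** The instruction [IJle 4 4] is an unconditional jump, a register being at most itself. In a
    conditional the jump is taken when the test succeeds, so the code of the first branch comes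
    last. *)
Fixpoint compile (o : nat) (c : com) : seq instr :=
  match c with
  | Seq c1 c2 => compile o c1 ++ compile (o + csize c1) c2
  | For x y c =>
      [:: IConst x 0; IJle y x (o + csize c + 5)] ++ compile (o + 2) c ++
      [:: IConst 4 1; IAdd x x 4; IJle 4 4 (o + 1)]
  | IfI x y c1 c2 =>
      [:: IJle x y (o + csize c2 + 2)] ++ compile (o + 1) c2 ++
      [:: IJle 4 4 (o + csize c1 + csize c2 + 2)] ++
      compile (o + csize c2 + 2) c1
  | IfF x y c1 c2 =>
      [:: FJle x y (o + csize c2 + 2)] ++ compile (o + 1) c2 ++
      [:: IJle 4 4 (o + csize c1 + csize c2 + 2)] ++
      compile (o + csize c2 + 2) c1
  | _ => blk c
  end.

Definition reg_instr (i : instr) : bool :=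
  match i with
  | IConst _ _ | IAdd _ _ _ | ISub _ _ _ | FConst _ _ | FAdd _ _ _
  | FSub _ _ _ | FMul _ _ _ | FDiv _ _ _ | FLoad _ _ => true
  | _ => false
  end.

Definition straight (i : instr) : bool :=
  if i is FStore _ _ then true else reg_instr i.

Definition ireg_written (i : instr) : seq nat :=
  match i with IConst x _ | IAdd x _ _ | ISub x _ _ => [:: x] | _ => [::] end.

Definition freg_written (i : instr) : seq nat :=
  match i with
  | FConst x _ | FAdd x _ _ | FSub x _ _ | FMul x _ _ | FDiv x _ _ | FLoad x _ =>
      [:: x]
  | _ => [::]
  end.

(** Footprints are computed from the syntax, so that non-interference conditions on concrete
    programs are settled by evaluation. *)
Fixpoint wri (c : com) : seq nat :=
  match c with
  | Reg i => ireg_written i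
  | Ld _ _ _ | St _ _ _ => [:: 3; 4]
  | Wr _ _ => [::]
  | Seq c1 c2 | IfI _ _ c1 c2 | IfF _ _ c1 c2 => wri c1 ++ wri c2
  | For x _ c => x :: 4 :: wri c
  end.

Fixpoint wrf (c : com) : seq nat :=
  match c with
  | Reg i => freg_written i
  | Ld x _ _ => [:: x]
  | St _ _ _ | Wr _ _ => [::]
  | Seq c1 c2 | IfI _ _ c1 c2 | IfF _ _ c1 c2 => wrf c1 ++ wrf c2
  | For _ _ c => wrf c
  end.

Fixpoint wra (c : com) : seq nat :=
  match c with
  | St m _ _ => [:: m]
  | Reg _ | Ld _ _ _ | Wr _ _ => [::]
  | Seq c1 c2 | IfI _ _ c1 c2 | IfF _ _ c1 c2 => wra c1 ++ wra c2
  | For _ _ c => wra c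
  end.

Fixpoint limits (c : com) : seq nat :=
  match c with
  | Seq c1 c2 | IfI _ _ c1 c2 | IfF _ _ c1 c2 => limits c1 ++ limits c2
  | For _ y c => y :: limits c
  | _ => [::]
  end.

Fixpoint wellformed (c : com) : bool :=
  match c with
  | Reg i => reg_instr i
  | Ld _ _ _ | St _ _ _ | Wr _ _ => true
  | Seq c1 c2 | IfI _ _ c1 c2 | IfF _ _ c1 c2 => wellformed c1 && wellformed c2
  | For x y c =>
      [&& wellformed c, x \notin wri c, y \notin wri c, x != y, x != 4 & y != 4]
  end%N.

Fixpoint array_safe (c : com) : bool :=
  match c with
  | Wr _ _ => false
  | Reg i => reg_instr i
  | St m _ _ => m < 8
  | Seq c1 c2 | IfI _ _ c1 c2 | IfF _ _ c1 c2 => array_safe c1 && array_safe c2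
  | For _ _ c => array_safe c
  | _ => true
  end%N.

(** Both branches of a conditional are charged, and each loop is charged [M] rounds, so the bound
    does not depend on the state. *)
Fixpoint time (M : nat) (c : com) : nat :=
  match c with
  | Seq c1 c2 => time M c1 + time M c2
  | For _ _ c => 2 + M * (time M c + 4)
  | IfI _ _ c1 c2 | IfF _ _ c1 c2 => time M c1 + time M c2 + 2
  | _ => size (blk c)
  end%N.

Fixpoint depth (c : com) : nat :=
  match c with
  | Seq c1 c2 | IfI _ _ c1 c2 | IfF _ _ c1 c2 => maxn (depth c1) (depth c2)
  | For _ _ c => (depth c).+1
  | _ => 0
  end%N.

Fixpoint weight (c : com) : nat :=
  match c with
  | Seq c1 c2 => weight c1 + weight c2
  | For _ _ c => weight c + 6
  | IfI _ _ c1 c2 | IfF _ _ c1 c2 => weight c1 + weight c2 + 2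
  | _ => size (blk c)
  end%N.

(** * Code size and a bound on the running time *)

Lemma size_compile c o : size (compile o c) = csize c.
Proof.
elim: c o => //= [c1 IH1 c2 IH2|x y c IH|x y c1 IH1 c2 IH2|x y c1 IH1 c2 IH2] o;
  rewrite ?size_cat /= ?size_cat /= ?IH ?IH1 ?IH2; lia.
Qed.

Lemma time_le M c : (0 < M)%N -> (time M c <= weight c * M ^ depth c)%N.
Proof.
move=> M0; have M1 e : (0 < M ^ e)%N by rewrite expn_gt0 M0.
have mono a b : (a <= b)%N -> (M ^ a <= M ^ b)%N by move=> ?; rewrite leq_pexp2l.
elim: c => [i|x m y|m y x|x y|c1 IH1 c2 IH2|x y c IH|x y c1 IH1 c2 IH2|x y c1 IH1 c2 IH2];
  rewrite ?muln1 //=.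
- have := mono _ _ (leq_maxl (depth c1) (depth c2)).
  have := mono _ _ (leq_maxr (depth c1) (depth c2)).
  nia.
- rewrite expnS; have := M1 (depth c); nia.
- have := mono _ _ (leq_maxl (depth c1) (depth c2)).
  have := mono _ _ (leq_maxr (depth c1) (depth c2)).
  have := M1 (maxn (depth c1) (depth c2)); nia.
- have := mono _ _ (leq_maxl (depth c1) (depth c2)).
  have := mono _ _ (leq_maxr (depth c1) (depth c2)).
  have := M1 (maxn (depth c1) (depth c2)); nia.
Qed.

(** * Semantics of the structured language *)

Section Semantics.
Variable R : realType.

Record st := State { ir : nat -> nat; fr : nat -> R; fm : nat -> R }.

Definition ex1 (s : st) (i : instr) : st :=
  match i with
  | IConst x v => State (upd (ir s) x v) (fr s) (fm s)
  | IAdd x y z => State (upd (ir s) x (ir s y + ir s z)%N) (fr s) (fm s)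
  | ISub x y z => State (upd (ir s) x (ir s y - ir s z)%N) (fr s) (fm s)
  | FConst x v => State (ir s) (upd (fr s) x v%:R) (fm s)
  | FAdd x y z => State (ir s) (upd (fr s) x (fr s y + fr s z)) (fm s)
  | FSub x y z => State (ir s) (upd (fr s) x (fr s y - fr s z)) (fm s)
  | FMul x y z => State (ir s) (upd (fr s) x (fr s y * fr s z)) (fm s)
  | FDiv x y z => State (ir s) (upd (fr s) x (fr s y / fr s z)) (fm s)
  | FLoad x y => State (ir s) (upd (fr s) x (fm s (ir s y))) (fm s)
  | FStore x y => State (ir s) (fr s) (upd (fm s) (ir s x) (fr s y))
  | _ => s
  end.

Definition reset (x : nat) (s : st) := ex1 s (IConst x 0).
Definition incr (x : nat) (s : st) := ex1 (ex1 s (IConst 4 1)) (IAdd x x 4).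

Fixpoint exec (c : com) (s : st) : st :=
  match c with
  | Seq c1 c2 => exec c2 (exec c1 s)
  | For x y c => iter (ir s y) (fun s => incr x (exec c s)) (reset x s)
  | IfI x y c1 c2 => if (ir s x <= ir s y)%N then exec c1 s else exec c2 s
  | IfF x y c1 c2 => if fr s x <= fr s y then exec c1 s else exec c2 s
  | _ => foldl ex1 s (blk c)
  end.

(* Locked: unification would otherwise execute the programs symbolically. *)
Definition den := locked exec.

Lemma denU : den = exec.
Proof. by rewrite /den -lock. Qed.

Lemma den_Reg i s : den (Reg i) s = ex1 s i.
Proof. by rewrite denU. Qed.

Lemma den_Ld_blk x m y s : den (Ld x m y) s = foldl ex1 s (blk (Ld x m y)).
Proof. by rewrite denU. Qed.

Lemma den_St_blk m y x s : den (St m y x) s = foldl ex1 s (blk (St m y x)).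
Proof. by rewrite denU. Qed.

Lemma den_Wr x y s : den (Wr x y) s = ex1 s (FStore x y).
Proof. by rewrite denU. Qed.

Lemma den_Seq c1 c2 s : den (c1 ;; c2) s = den c2 (den c1 s).
Proof. by rewrite denU. Qed.

Lemma den_For x y c s :
  den (For x y c) s = iter (ir s y) (fun s => incr x (den c s)) (reset x s).
Proof. by rewrite denU. Qed.

Lemma den_IfI x y c1 c2 s : den (IfI x y c1 c2) s =
  if (ir s x <= ir s y)%N then den c1 s else den c2 s.
Proof. by rewrite denU. Qed.

Lemma den_IfF x y c1 c2 s : den (IfF x y c1 c2) s =
  if fr s x <= fr s y then den c1 s else den c2 s.
Proof. by rewrite denU. Qed.

Lemma updE (T : Type) (f : nat -> T) x v : upd f x v x = v.
Proof. by rewrite /upd eqxx. Qed.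

Lemma upd_ne (T : Type) (f : nat -> T) x v y : y != x -> upd f x v y = f y.
Proof. by rewrite /upd => /negbTE ->. Qed.

Lemma ir_ex1 i s r : r \notin ireg_written i -> ir (ex1 s i) r = ir s r.
Proof. by case: i => //= [x v|x y z|x y z]; rewrite inE => rx; rewrite upd_ne. Qed.

Lemma fr_ex1 i s r : r \notin freg_written i -> fr (ex1 s i) r = fr s r.
Proof.
by case: i => //= [x v|x y z|x y z|x y z|x y z|x y]; rewrite inE => rx; rewrite upd_ne.
Qed.

Lemma ir_foldl l s r :
  r \notin flatten (map ireg_written l) -> ir (foldl ex1 s l) r = ir s r.
Proof.
elim: l s => //= i l IH s; rewrite mem_cat negb_or => /andP[ri rl].
by rewrite IH // ir_ex1.
Qed.

Lemma ir_incr x s r : r \notin [:: x; 4] -> ir (incr x s) r = ir s r.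
Proof.
by rewrite !inE negb_or => /andP[rx r4]; rewrite /incr /= !upd_ne.
Qed.

Lemma ir_incrE x s : x != 4 -> ir (incr x s) x = (ir s x).+1.
Proof. by move=> x4; rewrite /incr /= updE updE upd_ne // addn1. Qed.

Lemma ir_reset x s r : r != x -> ir (reset x s) r = ir s r.
Proof. by move=> rx; rewrite /reset /= upd_ne. Qed.

Lemma ir_den c s r : r \notin wri c -> ir (den c s) r = ir s r.
Proof.
elim: c s => [i|x m y|m y x|x y|c1 IH1 c2 IH2|x y c IH|x y c1 IH1 c2 IH2|x y c1 IH1 c2 IH2] s.
- by move=> H; rewrite den_Reg ir_ex1.
- by move=> H; rewrite den_Ld_blk ir_foldl //=; move: H; rewrite !inE; lia.
- by move=> H; rewrite den_St_blk ir_foldl //=; move: H; rewrite !inE; lia.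
- by rewrite den_Wr.
- by rewrite /= mem_cat negb_or den_Seq => /andP[? ?]; rewrite IH2 // IH1.
- rewrite [wri _]/= !inE !negb_or => /and3P[rx r4 rc]; rewrite den_For.
  elim: (ir s y) => [|t IHt]; first by rewrite ir_reset.
  by rewrite iterS ir_incr ?IH // !inE negb_or rx.
- by rewrite /= mem_cat negb_or den_IfI => /andP[? ?]; case: ifP; rewrite ?IH1 ?IH2.
- by rewrite /= mem_cat negb_or den_IfF => /andP[? ?]; case: ifP; rewrite ?IH1 ?IH2.
Qed.

(** * Simulation by the compiled code *)

Definition conf (o : nat) (s : st) (im : nat -> nat) (nc : nat) : config R :=
  Config o (ir s) im (fr s) (fm s) nc.

Lemma run_add P w t1 t2 (c : config R) :
  run P w (t1 + t2) c = run P w t2 (run P w t1 c).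
Proof. by rewrite /run addnC iterD. Qed.

Lemma step_at P pre i post w o s im nc :
  P = pre ++ i :: post -> o = size pre ->
  step P w (conf o s im nc) = exec_instr w (conf o s im nc) i.
Proof.
move=> -> ->; rewrite /step /halted /= size_cat /= ifF; last by apply/negbTE; lia.
by rewrite nth_cat ltnn subnn.
Qed.

Lemma exec_straight w i o s im nc : straight i ->
  exec_instr w (conf o s im nc) i = conf o.+1 (ex1 s i) im nc.
Proof. by case: i. Qed.

Lemma run_straight l P pre post w s im nc :
  all straight l -> P = pre ++ l ++ post ->
  run P w (size l) (conf (size pre) s im nc)
    = conf (size pre + size l) (foldl ex1 s l) im nc.
Proof.
elim: l pre s => [|i l IH] pre s; first by rewrite addn0.
rewrite [all _ _]/= => /andP[si sl] EP; rewrite [size (i :: l)]/= -add1n run_add.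
rewrite [run P w 1 _]/= (step_at _ _ _ _ EP) // exec_straight //.
rewrite -[(size pre).+1](size_rcons pre i) (IH (rcons pre i)) //.
  by rewrite size_rcons addSnnS add1n.
by rewrite EP -cats1 -catA.
Qed.

(** The code may sit at any offset in any program, which makes the property compose. Integer memory
    and coin counter are the same before and after, since no compiled instruction touches them. *)
Definition runs_within (M : nat) (c : com) (s : st) : Prop :=
  forall P pre post w im nc, P = pre ++ compile (size pre) c ++ post ->
  exists2 t, (t <= time M c)%N &
    run P w t (conf (size pre) s im nc) = conf (size pre + csize c) (den c s) im nc.

Lemma runs_within_seq M c1 c2 s :
  runs_within M c1 s -> runs_within M c2 (den c1 s) -> runs_within M (c1 ;; c2) s.
Proof.
move=> H1 H2 P pre post w im nc EP.
have [|t1 le1 E1] := H1 P pre (compile (size pre + csize c1) c2 ++ post) w im nc.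
  by rewrite EP /= -!catA.
have [|t2 le2 E2] := H2 P (pre ++ compile (size pre) c1) post w im nc.
  by rewrite EP size_cat size_compile /= -!catA.
exists (t1 + t2)%N; first exact: leq_add.
by move: E2; rewrite run_add E1 size_cat size_compile den_Seq /= addnA.
Qed.

(** The jump [j] is abstract so that integer and real tests share one proof. *)
Lemma runs_within_branch M (b : bool) j c1 c2 s P pre post w im nc :
  let o := size pre in
  (b -> runs_within M c1 s) -> (~~ b -> runs_within M c2 s) ->
  exec_instr w (conf o s im nc) j
    = conf (if b then o + csize c2 + 2 else o.+1)%N s im nc ->
  P = pre ++ ([:: j] ++ compile (o + 1) c2 ++
        [:: IJle 4 4 (o + csize c1 + csize c2 + 2)] ++
        compile (o + csize c2 + 2) c1) ++ post ->
  exists2 t, (t <= time M c1 + time M c2 + 2)%N &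
    run P w t (conf o s im nc)
      = conf (o + (csize c1 + csize c2 + 2)) (if b then den c1 s else den c2 s) im nc.
Proof.
move=> o; set j2 := IJle 4 4 _ => H1 H2 Ej EP.
have S1 : run P w 1 (conf o s im nc) =
    conf (if b then o + csize c2 + 2 else o.+1)%N s im nc.
  rewrite /run /= -Ej; apply: step_at (erefl o).
  by rewrite EP -!catA; congr (_ ++ _).
case: b H1 H2 {Ej} S1 => [H1 _|_ H2] S1.
- pose pre2 := pre ++ [:: j] ++ compile (o + 1) c2 ++ [:: j2].
  have sp2 : size pre2 = (o + csize c2 + 2)%N.
    by rewrite !size_cat size_compile /= -/o; lia.
  have [|t let_ Et] := H1 isT P pre2 post w im nc.
    by rewrite sp2 EP /pre2 -!catA.
  exists (1 + t)%N; first by lia.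
  rewrite run_add S1 -sp2 Et sp2; congr conf; lia.
- pose pre2 := pre ++ [:: j].
  have sp2 : size pre2 = o.+1 by rewrite size_cat addn1.
  have [|t let_ Et] := H2 isT
    P pre2 ([:: j2] ++ compile (o + csize c2 + 2) c1 ++ post) w im nc.
    by rewrite sp2 EP /pre2 -!catA addn1.
  exists (1 + (t + 1))%N; first by lia.
  rewrite run_add S1 -sp2 run_add Et sp2 /run /=.
  rewrite (step_at (pre := pre2 ++ compile (o + 1) c2) (i := j2)
    (post := (compile (o + csize c2 + 2) c1 ++ post))).
  + by rewrite /= leqnn; congr conf; lia.
  + by rewrite EP /pre2 -!catA.
  + by rewrite size_cat sp2 size_compile.
Qed.

(** No limit register is written by [c], so a loop finds its limit unchanged whenever it is entered;
    this is why bounding the limits in the initial state is enough. *)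
Lemma runs_within_limits M c s : wellformed c ->
  {in limits c, forall y, y \notin wri c /\ (ir s y <= M)%N} -> runs_within M c s.
Proof.
have L12 c1 c2 s' : {in limits c1 ++ limits c2,
  forall y, y \notin wri c1 ++ wri c2 /\ (ir s' y <= M)%N} ->
    {in limits c1, forall y, y \notin wri c1 /\ (ir s' y <= M)%N} /\
    {in limits c2, forall y, [/\ y \notin wri c1, y \notin wri c2 & (ir s' y <= M)%N]}.
  move=> L; split=> y yc; have [] := L y; rewrite ?mem_cat ?yc ?orbT //.
    by rewrite negb_or => /andP[].
  by rewrite negb_or => /andP[].
elim: c s => [i|x m y|m y x|x y|c1 IH1 c2 IH2|x y c IH|x y c1 IH1 c2 IH2|x y c1 IH1 c2 IH2] s.
- move=> wc _ P pre post w im nc EP; exists 1%N => //; rewrite den_Reg.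
  apply: (@run_straight [:: i] _ _ post) => //=.
  by rewrite andbT; case: i wc {EP}.
- by move=> _ _ P pre post w im nc EP; exists 7%N => //; rewrite den_Ld_blk; apply: run_straight EP.
- by move=> _ _ P pre post w im nc EP; exists 7%N => //; rewrite den_St_blk; apply: run_straight EP.
- by move=> _ _ P pre post w im nc EP; exists 1%N => //; rewrite den_Wr; apply: run_straight EP.
- move=> /= /andP[w1 w2] /L12[L1 L2]; apply: runs_within_seq; first exact: IH1.
  by apply: IH2 => // y yc; have [y1 y2 yM] := L2 y yc; rewrite ir_den.
- move=> /= /and5P[wc xc yc xy /andP[x4 y4]] L P pre post w im nc EP; rewrite den_For.
  have yM : (ir s y <= M)%N by have [] := L y; rewrite ?mem_head.
  set o := size pre in EP *.
  pose pre2 := pre ++ [:: IConst x 0; IJle y x (o + csize c + 5)].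
  pose tl := [:: IConst 4 1; IAdd x x 4; IJle 4 4 (o + 1)].
  have so2 : size pre2 = (o + 2)%N by rewrite size_cat.
  have EP2 : P = pre2 ++ compile (size pre2) c ++ (tl ++ post).
    by rewrite so2 EP /pre2 /tl -!catA.
  (* State after [t] rounds: control is at the loop test, one past the initialisation of the
     counter. A round costs the body plus 4: the test, two instructions for the increment, and the
     jump back. *)
  have loop t : (t <= ir s y)%N -> exists2 u, (u <= 1 + t * (time M c + 4))%N &
     run P w u (conf o s im nc)
       = conf (o + 1) (iter t (fun s => incr x (den c s)) (reset x s)) im nc
       /\ (ir (iter t (fun s => incr x (den c s)) (reset x s)) x = t).
    elim: t => [_|t IHt lt].
      exists 1%N => //; split; last by rewrite /reset /= updE.
      rewrite /run /= (step_at (pre := pre) (i := IConst x 0)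
        (post := (IJle y x (o + csize c + 5) :: compile (o + 2) c ++ tl ++ post))) //; last by rewrite EP /tl -!catA.
      by rewrite exec_straight // addn1.
    have [u leu [Eu Ex]] := IHt (ltnW lt).
    set s1 := iter t _ _ in Eu Ex.
    have s1r r : r \notin [:: x, 4 & wri c]%N -> ir s1 r = ir s r.
      rewrite !inE !negb_or => /and3P[rx r4 rc]; rewrite /s1.
      elim: (t) => [|t' IH']; first by rewrite ir_reset.
      by rewrite iterS ir_incr ?ir_den // !inE negb_or rx.
    have ys1 : ir s1 y = ir s y by rewrite s1r // !inE !negb_or eq_sym xy y4.
    have [|v lev Ev] := IH s1 wc _ P pre2 (tl ++ post) w im nc EP2.
      move=> z zc; have [] := L z; first by rewrite in_cons zc orbT.
      move=> zw zM; rewrite s1r //; split => //.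
      by move: zw; rewrite !inE !negb_or => /and3P[].
    have S1 : step P w (conf (o + 1) s1 im nc) = conf (o + 2) s1 im nc.
      rewrite (step_at (pre := rcons pre (IConst x 0)) (i := IJle y x (o + csize c + 5))
        (post := (compile (o + 2) c ++ tl ++ post))).
      * by rewrite /= Ex ys1 leqNgt lt /= /conf addn2 addn1.
      * by rewrite EP /tl -cats1 -!catA.
      * by rewrite size_rcons addn1.
    have S2 : run P w 2 (conf (size (pre2 ++ compile (size pre2) c)) (den c s1) im nc)
        = conf (o + csize c + 4) (incr x (den c s1)) im nc.
      rewrite (@run_straight [:: IConst 4 1; IAdd x x 4] P _ (IJle 4 4 (o + 1) :: post)) //.
        by rewrite size_cat so2 size_compile /=; congr conf; lia.
      by rewrite EP2 /tl -!catA.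
    have S3 : step P w (conf (o + csize c + 4) (incr x (den c s1)) im nc) = conf (o + 1) (incr x (den c s1)) im nc.
      rewrite (step_at (pre := pre2 ++ compile (size pre2) c ++ [:: IConst 4 1; IAdd x x 4]) (i := IJle 4 4 (o + 1)) (post := post)).
      * by rewrite /= leqnn.
      * by rewrite EP2 /tl -!catA.
      * by rewrite /pre2 !size_cat size_compile /= -/o; lia.
    exists (u + (1 + (v + (2 + 1))))%N; first by rewrite mulSn; lia.
    split; last first.
      by rewrite iterS -/s1 ir_incrE // ir_den // Ex.
    rewrite run_add Eu run_add [run P w 1 _]S1 -so2 run_add Ev.
    by rewrite run_add; move: S2; rewrite size_cat size_compile => ->.
  have [u leu [Eu Ex]] := loop _ (leqnn _).
  exists (u + 1)%N.
    have : (ir s y * (time M c + 4) <= M * (time M c + 4))%N by rewrite leq_mul2r yM orbT.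
    rewrite /=; lia.
  rewrite run_add Eu /run /=.
  set s1 := iter _ _ _ in Eu Ex *.
  have ys1 : ir s1 y = ir s y.
    rewrite /s1; set t := (X in iter X); elim: t => [|t' IH'].
      by rewrite ir_reset 1?eq_sym.
    by rewrite iterS ir_incr ?ir_den // !inE negb_or eq_sym xy.
  rewrite (step_at (pre := rcons pre (IConst x 0)) (i := IJle y x (o + csize c + 5))
    (post := (compile (o + 2) c ++ tl ++ post))).
  + by rewrite /= Ex ys1 leqnn /conf addnA.
  + by rewrite EP /tl -cats1 -!catA.
  + by rewrite size_rcons addn1.
- move=> /= /andP[w1 w2] /L12[L1 L2] P pre post w im nc EP; rewrite den_IfI.
  apply: runs_within_branch EP => [_|_|]; first exact: IH1.
    by apply: IH2 => // z zc; have [] := L2 z zc.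
  by rewrite /=; case: ifP.
- move=> /= /andP[w1 w2] /L12[L1 L2] P pre post w im nc EP; rewrite den_IfF.
  apply: runs_within_branch EP => [_|_|]; first exact: IH1.
    by apply: IH2 => // z zc; have [] := L2 z zc.
  by rewrite /=; case: ifP.
Qed.

(** * Interleaved arrays and frame conditions *)

Definition fa (s : st) (m i : nat) : R := fm s (ir s 5 + (8 * i + m))%N.

(** The bound [m < 8] is what makes the interleaved addresses of different arrays disjoint. The last
    clause protects the input, which lies below [i[5]]. *)
Definition same (wi wf wa : seq nat) (s s' : st) : Prop :=
  [/\ forall r, r \notin wi -> ir s' r = ir s r,
      forall r, r \notin wf -> fr s' r = fr s r,
      forall m i, (m < 8)%N -> m \notin wa -> fa s' m i = fa s m i &
      forall a, (a < ir s 5)%N -> fm s' a = fm s a].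

Lemma same_trans wi wf wa s1 s2 s3 : 5 \notin wi ->
  same wi wf wa s1 s2 -> same wi wf wa s2 s3 -> same wi wf wa s1 s3.
Proof.
move=> w5 [i1 f1 a1 m1] [i2 f2 a2 m2]; split=> [r rw|r rw|m i m8 mw|a ha].
- by rewrite i2 ?i1.
- by rewrite f2 ?f1.
- by rewrite a2 ?a1.
- by rewrite m2 ?m1 // i1.
Qed.

Lemma same_sub wi wf wa wi' wf' wa' s s' :
  {subset wi <= wi'} -> {subset wf <= wf'} -> {subset wa <= wa'} ->
  same wi wf wa s s' -> same wi' wf' wa' s s'.
Proof.
move=> Si Sf Sa [H1 H2 H3 H4]; split=> [r rw|r rw|m i m8 mw|//].
- by apply: H1; apply: contra rw => /Si.
- by apply: H2; apply: contra rw => /Sf.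
- by apply: H3 => //; apply: contra mw => /Sa.
Qed.

Definition addr_state (s : st) (m y : nat) := foldl ex1 s (array_addr m y).

Lemma ir_addr s m y : ir (addr_state s m y) 3 = (ir s 5 + (8 * ir s y + m))%N.
Proof. by rewrite /= /upd /=; lia. Qed.

Lemma fr_Ld x m y s : fr (den (Ld x m y) s) = upd (fr s) x (fa s m (ir s y)).
Proof. by rewrite den_Ld_blk /fa -ir_addr. Qed.

Lemma fm_Ld x m y s : fm (den (Ld x m y) s) = fm s.
Proof. by rewrite den_Ld_blk. Qed.

Lemma fm_St m y x s :
  fm (den (St m y x) s) = upd (fm s) (ir s 5 + (8 * ir s y + m))%N (fr s x).
Proof. by rewrite den_St_blk -ir_addr. Qed.

Lemma fr_St m y x s : fr (den (St m y x) s) = fr s.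
Proof. by rewrite den_St_blk. Qed.

Lemma fa_St m y x s m' i : (m < 8)%N -> (m' < 8)%N ->
  fa (den (St m y x) s) m' i
    = if (m' == m) && (i == ir s y) then fr s x else fa s m' i.
Proof.
move=> m8 m8'; rewrite /fa fm_St ir_den // /upd.
case: ifP => H1; case: ifP => H2 //; exfalso; lia.
Qed.

Lemma same_den c s : array_safe c -> 5 \notin wri c ->
  same (wri c) (wrf c) (wra c) s (den c s).
Proof.
elim: c s => [i|x m y|m y x|x y|c1 IH1 c2 IH2|x y c IH|x y c1 IH1 c2 IH2|x y c1 IH1 c2 IH2] s.
- move=> ri w5; split=> [r rw|r rw|m j m8 _|a ha].
  + exact: ir_den.
  + by rewrite den_Reg fr_ex1.
  + by rewrite /fa ir_den // den_Reg; case: i ri {w5}.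
  + by rewrite den_Reg; case: i ri {w5}.
- move=> _ _; split=> [r rw|r|m' j _ _|a ha].
  + exact: ir_den.
  + by rewrite inE fr_Ld => rx; rewrite upd_ne.
  + by rewrite /fa ir_den // fm_Ld.
  + by rewrite fm_Ld.
- move=> m8 _; split=> [r rw|r rw|m' j m8' |a ha].
  + exact: ir_den.
  + by rewrite fr_St.
  + by rewrite inE => /negbTE mm; rewrite fa_St // mm.
  + by rewrite fm_St upd_ne //; apply: contraTneq ha => ->; rewrite -leqNgt leq_addr.
- by [].
- move=> /= /andP[s1 s2]; rewrite mem_cat negb_or den_Seq => /andP[w1 w2].
  apply: (@same_trans _ _ _ _ (den c1 s)); first by rewrite mem_cat negb_or w1.
    by apply: same_sub (IH1 _ s1 w1) => z zc; rewrite mem_cat zc.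
  by apply: same_sub (IH2 _ s2 w2) => z zc; rewrite mem_cat zc orbT.
- move=> sc; rewrite [wri _]/= !inE !negb_or => /and3P[x5 _ w5].
  have W5 : 5 \notin [:: x, 4 & wri c] by rewrite !inE !negb_or x5.
  rewrite den_For; set t := ir s y; elim: t => [|t IHt].
    split=> // [r|m i _ _].
      by rewrite !inE !negb_or => /and3P[rx _ _]; rewrite ir_reset.
    by rewrite /fa ir_reset.
  apply: same_trans IHt _ => //; rewrite iterS; set s1 := iter _ _ _.
  apply: (@same_trans _ _ _ _ (den c s1)) => //.
    by apply: same_sub (IH s1 sc w5) => // z zc; rewrite !inE zc !orbT.
  split=> // [r|m i _ _]; first by rewrite !inE !negb_or => /and3P[? ? _]; rewrite ir_incr // !inE negb_or; apply/andP.
  by rewrite /fa ir_incr // !inE negb_or x5.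
- move=> /= /andP[s1 s2]; rewrite mem_cat negb_or den_IfI => /andP[w1 w2].
  case: ifP => _.
    by apply: same_sub (IH1 _ s1 w1) => z zc; rewrite mem_cat zc.
  by apply: same_sub (IH2 _ s2 w2) => z zc; rewrite mem_cat zc orbT.
- move=> /= /andP[s1 s2]; rewrite mem_cat negb_or den_IfF => /andP[w1 w2].
  case: ifP => _.
    by apply: same_sub (IH1 _ s1 w1) => z zc; rewrite mem_cat zc.
  by apply: same_sub (IH2 _ s2 w2) => z zc; rewrite mem_cat zc orbT.
Qed.

(** * Rewriting rules and loop invariants *)

Definition clean (c : com) := [&& wellformed c, array_safe c & 5 \notin wri c].

Lemma den_IConst x v s :
  den (Reg (IConst x v)) s = State (upd (ir s) x v) (fr s) (fm s).
Proof. exact: den_Reg. Qed.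

Lemma den_IAdd x y z s :
  den (Reg (IAdd x y z)) s = State (upd (ir s) x (ir s y + ir s z)%N) (fr s) (fm s).
Proof. exact: den_Reg. Qed.

Lemma den_ISub x y z s :
  den (Reg (ISub x y z)) s = State (upd (ir s) x (ir s y - ir s z)%N) (fr s) (fm s).
Proof. exact: den_Reg. Qed.

Lemma den_FConst x v s :
  den (Reg (FConst x v)) s = State (ir s) (upd (fr s) x v%:R) (fm s).
Proof. exact: den_Reg. Qed.

Lemma den_FAdd x y z s :
  den (Reg (FAdd x y z)) s = State (ir s) (upd (fr s) x (fr s y + fr s z)) (fm s).
Proof. exact: den_Reg. Qed.

Lemma den_FSub x y z s :
  den (Reg (FSub x y z)) s = State (ir s) (upd (fr s) x (fr s y - fr s z)) (fm s).
Proof. exact: den_Reg. Qed.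

Lemma den_FMul x y z s :
  den (Reg (FMul x y z)) s = State (ir s) (upd (fr s) x (fr s y * fr s z)) (fm s).
Proof. exact: den_Reg. Qed.

Lemma den_FDiv x y z s :
  den (Reg (FDiv x y z)) s = State (ir s) (upd (fr s) x (fr s y / fr s z)) (fm s).
Proof. exact: den_Reg. Qed.

Lemma den_FLoad x y s :
  den (Reg (FLoad x y)) s = State (ir s) (upd (fr s) x (fm s (ir s y))) (fm s).
Proof. exact: den_Reg. Qed.

Lemma ir_addr_state s m y :
  ir (addr_state s m y) = upd (upd (ir s) 3 (ir s 5 + (8 * ir s y + m))%N) 4 m.
Proof.
apply/funext => r; rewrite -ir_addr.
by rewrite /addr_state /array_addr /= /upd; case: eqP => [->|_] //=; case: eqP.
Qed.

Lemma den_Ld x m y s : den (Ld x m y) s =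
  State (upd (upd (ir s) 3 (ir s 5 + (8 * ir s y + m))%N) 4 m)
    (upd (fr s) x (fa s m (ir s y))) (fm s).
Proof. by rewrite den_Ld_blk /fa -ir_addr_state -ir_addr. Qed.

Lemma den_St m y x s : den (St m y x) s =
  State (upd (upd (ir s) 3 (ir s 5 + (8 * ir s y + m))%N) 4 m) (fr s)
    (upd (fm s) (ir s 5 + (8 * ir s y + m))%N (fr s x)).
Proof. by rewrite den_St_blk -ir_addr_state -ir_addr. Qed.

Lemma fa_state a b s m i : a 5 = ir s 5 -> fa (State a b (fm s)) m i = fa s m i.
Proof. by rewrite /fa /= => ->. Qed.

Lemma fr_incr x s : fr (incr x s) = fr s. Proof. by []. Qed.
Lemma fm_incr x s : fm (incr x s) = fm s. Proof. by []. Qed.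
Lemma fr_reset x s : fr (reset x s) = fr s. Proof. by []. Qed.

Lemma fa_incr x s m i : x != 5 -> fa (incr x s) m i = fa s m i.
Proof. by move=> x5; rewrite /fa ir_incr // !inE negb_or eq_sym x5. Qed.

Lemma fa_reset x s m i : x != 5 -> fa (reset x s) m i = fa s m i.
Proof. by move=> x5; rewrite /fa ir_reset // eq_sym. Qed.

Lemma fr_den c s r : r \notin wrf c -> fr (den c s) r = fr s r.
Proof.
elim: c s => [i|x m y|m y x|x y|c1 IH1 c2 IH2|x y c IH|x y c1 IH1 c2 IH2|x y c1 IH1 c2 IH2] s.
- by rewrite den_Reg; apply: fr_ex1.
- by rewrite den_Ld inE => rx; rewrite /= upd_ne.
- by rewrite den_St.
- by rewrite den_Wr.
- by rewrite /= mem_cat negb_or den_Seq => /andP[? ?]; rewrite IH2 // IH1.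
- rewrite [wrf _]/= den_For => rc.
  by elim: (ir s y) => [|t IHt] //; rewrite iterS fr_incr IH.
- by rewrite /= mem_cat negb_or den_IfI => /andP[? ?]; case: ifP; rewrite ?IH1 ?IH2.
- by rewrite /= mem_cat negb_or den_IfF => /andP[? ?]; case: ifP; rewrite ?IH1 ?IH2.
Qed.

Lemma fa_den c s m i : array_safe c -> 5 \notin wri c -> (m < 8)%N -> m \notin wra c ->
  fa (den c s) m i = fa s m i.
Proof. by move=> sc c5 m8 mc; have [_ _ H _] := same_den s sc c5; apply: H. Qed.

(** This rule frames integer registers only, and so also covers loops that write raw memory or move
    the array base, such as [Output] and [InitBase]. For clean loops [for_inv] frames the whole
    state. *)
Lemma for_inv_wf (Inv : nat -> st -> Prop) x y c s : wellformed (For x y c) ->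
  Inv 0 (reset x s) ->
  (forall t s', (t < ir s y)%N -> ir s' x = t ->
     (forall r, r \notin wri (For x y c) -> ir s' r = ir s r) ->
     Inv t s' -> Inv t.+1 (incr x (den c s'))) ->
  Inv (ir s y) (den (For x y c) s).
Proof.
move=> wf I0 IS; rewrite den_For.
have /and5P[wc xc yc xy /andP[x4 y4]] := wf.
have : (ir s y <= ir s y)%N by [].
suff H t : (t <= ir s y)%N -> let s' := iter t (fun s => incr x (den c s)) (reset x s) in
   [/\ Inv t s', ir s' x = t &
       forall r, r \notin wri (For x y c) -> ir s' r = ir s r] by case/H.
elim: t => [_|t IHt lt] s'.
  split=> // [|r]; first by rewrite /s' /reset /= updE.
  by rewrite [wri _]/= !inE !negb_or => /and3P[rx _ _]; rewrite ir_reset.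
have [It xt St] := IHt (ltnW lt); rewrite /s' iterS; set s1 := iter t _ _ in It xt St *.
split; first by apply: IS.
  by rewrite ir_incrE // ir_den // xt.
move=> r rw; move: (rw); rewrite [wri _]/= !inE !negb_or => /and3P[rx r4 rc].
by rewrite ir_incr ?ir_den ?St // !inE negb_or rx.
Qed.

Lemma for_inv (Inv : nat -> st -> Prop) x y c s :
  clean (For x y c) -> let w := For x y c in
  Inv 0 (reset x s) ->
  (forall t s', (t < ir s y)%N -> ir s' x = t ->
     same (wri w) (wrf w) (wra w) s s' -> Inv t s' -> Inv t.+1 (incr x (den c s'))) ->
  Inv (ir s y) (den w s).
Proof.
move=> /and3P[wf sf w5] w I0 IS.
pose J t s' := Inv t s' /\ same (wri w) (wrf w) (wra w) s s'.
have [x5 wc5] : 5 != x /\ 5 \notin wri c.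
  by move: w5; rewrite [wri _]/= !inE !negb_or => /and3P[].
suff [] : J (ir s y) (den w s) by [].
apply: (@for_inv_wf J) => //.
  split=> //; split=> // [r|m i _ _].
    by rewrite !inE !negb_or => /and3P[rx _ _]; rewrite ir_reset.
  by rewrite fa_reset // eq_sym.
move=> t s' lt xt _ [It St]; split; first exact: IS.
apply: (same_trans w5 St); apply: (@same_trans _ _ _ _ (den c s')) => //.
  by apply: same_sub (@same_den c s' sf wc5) => // z zc; rewrite [wri _]/= !inE zc !orbT.
split=> // [r|m i _ _]; last by rewrite fa_incr // eq_sym.
by rewrite !inE !negb_or => /and3P[rx r4 _]; rewrite ir_incr // !inE negb_or rx.
Qed.

End Semantics.

(** * Regression in the l1 norm and column subsets *)

Section L1Regression.
Variables (R : realType) (n : nat).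
Implicit Types (u v b : 'cV[R]_n) (h q : nat -> 'cV[R]_n) (x : nat -> R).

Definition cnorm v : R := \sum_i `|v i 0|.

Lemma cnorm_ge0 v : 0 <= cnorm v.
Proof. exact: sumr_ge0. Qed.

Lemma cnorm0 : cnorm 0 = 0.
Proof. by rewrite /cnorm big1 // => i _; rewrite mxE normr0. Qed.

Lemma cnormD u v : cnorm (u + v) <= cnorm u + cnorm v.
Proof.
by rewrite /cnorm -big_split /=; apply: ler_sum => i _; rewrite mxE ler_normD.
Qed.

Lemma cnormZ a v : cnorm (a *: v) = `|a| * cnorm v.
Proof. by rewrite /cnorm mulr_sumr; apply: eq_bigr => i _; rewrite mxE normrM. Qed.

Lemma cnormN v : cnorm (- v) = cnorm v.
Proof. by rewrite -scaleN1r cnormZ normrN1 mul1r. Qed.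

Lemma cnormB u v : cnorm (u - v) <= cnorm u + cnorm v.
Proof. by rewrite -(cnormN v) cnormD. Qed.

Lemma cnorm_sum (I : Type) (r : seq I) (F : I -> 'cV[R]_n) :
  cnorm (\sum_(i <- r) F i) <= \sum_(i <- r) cnorm (F i).
Proof.
elim/big_ind2: _ => [|a u b v ua vb|//]; first by rewrite cnorm0.
exact: le_trans (cnormD _ _) (lerD ua vb).
Qed.

Lemma cnorm_eq0 v : cnorm v = 0 -> v = 0.
Proof.
move=> /eqP; rewrite psumr_eq0 // => /allP H; apply/matrixP => i j.
by rewrite ord1 mxE; apply/eqP; rewrite -normr_eq0; apply: (implyP (H i _)); rewrite ?mem_index_enum.
Qed.

Definition entry v (i : nat) : R := if insub i is Some j then v j 0 else 0.

Lemma entry_ord v (i : 'I_n) : entry v i = v i 0.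
Proof. by rewrite /entry valK. Qed.

Lemma entryD u v i : entry (u + v) i = entry u i + entry v i.
Proof. by rewrite /entry; case: insubP => [j _ _|_]; rewrite ?mxE ?addr0. Qed.

Lemma entryZ a v i : entry (a *: v) i = a * entry v i.
Proof. by rewrite /entry; case: insubP => [j _ _|_]; rewrite ?mxE ?mulr0. Qed.

Lemma entryB u v i : entry (u - v) i = entry u i - entry v i.
Proof. by rewrite -scaleN1r entryD entryZ mulN1r. Qed.

Lemma entry0 i : entry 0 i = 0.
Proof. by rewrite /entry; case: insubP => // j _ _; rewrite mxE. Qed.

Lemma entry_le_cnorm v i : `|entry v i| <= cnorm v.
Proof.
rewrite /entry; case: insubP => [j _ _|_]; last by rewrite normr0 cnorm_ge0.
by rewrite /cnorm (bigD1 j) //= lerDl sumr_ge0.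
Qed.

(** * Pivots and Gaussian elimination *)

Fixpoint argmax (f : nat -> R) (m : nat) : nat :=
  if m is m'.+1 then
    let p := argmax f m' in if `|f m'| <= `|f p| then p else m'
  else 0%N.

Lemma argmax_lt f m : (0 < m)%N -> (argmax f m < m)%N.
Proof.
case: m => // m _; elim: m => [|m IH] /=; first by rewrite lexx.
by case: ifP => // _; apply: leq_trans IH _.
Qed.

Lemma argmaxP f m i : (i < m)%N -> `|f i| <= `|f (argmax f m)|.
Proof.
elim: m => // m IH; rewrite ltnS leq_eqVlt => /orP[/eqP->|im] /=.
  by case: ifP.
by case: (leP `|f m|) => H; [exact: IH|exact: le_trans (IH im) (ltW H)].
Qed.

Definition piv v : nat := argmax (entry v) n.

Lemma entry_piv v i : `|entry v i| <= `|entry v (piv v)|.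
Proof.
rewrite {1}/entry; case: insubP => [j _ _|_]; last by rewrite normr0.
by rewrite -entry_ord argmaxP.
Qed.

Lemma cnorm_piv v : cnorm v <= n%:R * `|entry v (piv v)|.
Proof.
rewrite /cnorm mulr_natl -[X in _ *+ X]card_ord -sumr_const.
by apply: ler_sum => i _; rewrite -entry_ord entry_piv.
Qed.

Lemma entry_piv_eq0 v : entry v (piv v) = 0 -> v = 0.
Proof.
move=> v0; apply: cnorm_eq0; apply/eqP; rewrite eq_le cnorm_ge0 andbT.
by apply: le_trans (cnorm_piv v) _; rewrite v0 normr0 mulr0.
Qed.

(** A zero vector has pivot entry 0, and division by 0 gives the coefficient 0, so it leaves [b]
    unchanged. Hence elimination can always run over all [k] slots, filled or not. *)
Fixpoint eliminate h (l : nat) b : 'cV[R]_n :=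
  if l is l'.+1 then
    let b' := eliminate h l' b in
    b' - (entry b' (piv (h l')) / entry (h l') (piv (h l'))) *: h l'
  else b.

Definition elim_coef h b (l : nat) : R :=
  entry (eliminate h l b) (piv (h l)) / entry (h l) (piv (h l)).

Lemma eliminateE h l b :
  eliminate h l b = b - \sum_(m < l) elim_coef h b m *: h m.
Proof.
elim: l => [|l IH]; first by rewrite big_ord0 subr0.
by rewrite big_ord_recr /= -/(elim_coef h b l) IH opprD addrA.
Qed.

Lemma eq_eliminate h h' l b : (forall m, (m < l)%N -> h m = h' m) ->
  eliminate h l b = eliminate h' l b.
Proof.
by elim: l => //= l IH H; rewrite IH ?H // => m ml; apply: H; apply: ltnW.
Qed.

Lemma eliminateD h l u v : eliminate h l (u + v) = eliminate h l u + eliminate h l v.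
Proof.
elim: l => //= l ->; rewrite entryD mulrDl scalerDl opprD.
by rewrite addrACA.
Qed.

Lemma eliminateZ h l a v : eliminate h l (a *: v) = a *: eliminate h l v.
Proof. by elim: l => //= l ->; rewrite entryZ -mulrA -scalerA scalerBr. Qed.

Lemma eliminate0 h l : eliminate h l 0 = 0.
Proof. by rewrite -[0 in LHS](scale0r (0 : 'cV[R]_n)) eliminateZ scale0r. Qed.

(** The pivot is an entry of maximal absolute value, hence at least [cnorm (h l) / n]; the
    subtracted multiple of [h l] has norm at most [n] times that of the current vector. *)
Lemma cnorm_eliminate h l b : cnorm (eliminate h l b) <= (1 + n%:R) ^+ l * cnorm b.
Proof.
elim: l => [|l IH]; first by rewrite expr0 mul1r.
rewrite exprS -mulrA; apply: (@le_trans _ _ ((1 + n%:R) * cnorm (eliminate h l b))); last first.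
  by rewrite ler_wpM2l // addr_ge0 ?ler0n.
rewrite /=; set c := eliminate h l b; apply: le_trans (cnormB _ _) _.
rewrite mulrDl mul1r lerD2l cnormZ normrM normfV.
have [->|p0] := eqVneq (entry (h l) (piv (h l))) 0.
  by rewrite normr0 invr0 mulr0 mul0r mulr_ge0 ?ler0n ?cnorm_ge0.
rewrite -mulrA mulrC; apply: ler_pM; rewrite ?entry_le_cnorm ?mulr_ge0 ?invr_ge0 ?cnorm_ge0 //.
by rewrite mulrC ler_pdivrMr ?normr_gt0 // cnorm_piv.
Qed.

Variable k : nat.

(* A zero vector [h m] imposes nothing, since [x / 0 = 0]. *)
Definition triangular h : Prop := forall m l, (m < l)%N -> (l < k)%N ->
  entry (h l) (piv (h m)) / entry (h m) (piv (h m)) = 0.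

(** The steps before [l] do nothing, as [h l] vanishes at the earlier pivots; step [l] subtracts
    [h l] from itself, and 0 stays 0. *)
Lemma eliminate_member h l : triangular h -> (l < k)%N -> eliminate h k (h l) = 0.
Proof.
move=> tr lk; have low m : (m <= l)%N -> eliminate h m (h l) = h l.
  elim: m => //= m IH ml; rewrite IH; last exact: ltnW.
  by rewrite tr // scale0r subr0.
suff high m : (l < m)%N -> eliminate h m (h l) = 0 by exact: high.
elim: m => // m IH; rewrite ltnS leq_eqVlt => /orP[/eqP<-|lm] /=.
  rewrite low //; have [p0|p0] := eqVneq (entry (h l) (piv (h l))) 0.
    by rewrite (entry_piv_eq0 p0) scaler0 subr0.
  by rewrite divff // scale1r subrr.
by rewrite IH // entry0 mul0r scale0r subr0.
Qed.

(** Step [m] clears the pivot of [h m], and the later vectors vanish there, so it stays clear. This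
    keeps the basis triangular when an eliminated column is added. *)
Lemma entry_eliminate h m b : triangular h -> (m < k)%N ->
  entry (eliminate h k b) (piv (h m)) / entry (h m) (piv (h m)) = 0.
Proof.
move=> tr mk; suff H l : (m < l)%N -> (l <= k)%N ->
    entry (eliminate h l b) (piv (h m)) / entry (h m) (piv (h m)) = 0 by exact: H.
elim: l => // l IH; rewrite ltnS leq_eqVlt => /orP[/eqP<-|ml] lk /=.
  rewrite entryB entryZ.
  have [->|p0] := eqVneq (entry (h m) (piv (h m))) 0; first by rewrite invr0 !mulr0.
  by rewrite divfK // subrr mul0r.
by rewrite entryB entryZ mulrBl -[X in _ - X]mulrA tr // mulr0 subr0 IH // ltnW.
Qed.

(** * Spans and conditioned bases *)

Definition spanned h v : Prop := exists x, v = \sum_(l < k) x l *: h l.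

Lemma spanned0 h : spanned h 0.
Proof. by exists (fun=> 0); rewrite big1 // => l _; rewrite scale0r. Qed.

Lemma spannedD h u v : spanned h u -> spanned h v -> spanned h (u + v).
Proof.
move=> [x ->] [y ->]; exists (fun l => x l + y l); rewrite -big_split /=.
by apply: eq_bigr => l _; rewrite scalerDl.
Qed.

Lemma spannedZ h a v : spanned h v -> spanned h (a *: v).
Proof.
move=> [x ->]; exists (fun l => a * x l); rewrite scaler_sumr.
by apply: eq_bigr => l _; rewrite scalerA.
Qed.

Lemma spannedB h u v : spanned h u -> spanned h v -> spanned h (u - v).
Proof. by move=> hu hv; apply: spannedD => //; rewrite -scaleN1r; apply: spannedZ. Qed.

Lemma spanned_member h l : (l < k)%N -> spanned h (h l).
Proof.
move=> lk; exists (fun m => (m == l)%:R); rewrite (bigD1 (Ordinal lk)) //= eqxx scale1r.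
rewrite big1 ?addr0 // => m; rewrite -val_eqE /= => /negbTE ->.
by rewrite scale0r.
Qed.

Lemma spanned_sum h (m : nat) (F : 'I_m -> 'cV[R]_n) :
  (forall i, spanned h (F i)) -> spanned h (\sum_i F i).
Proof.
move=> H; elim/big_ind: _ => [|u v|//]; [exact: spanned0|exact: spannedD].
Qed.

Lemma spanned_trans h q v : (forall l, (l < k)%N -> spanned q (h l)) ->
  spanned h v -> spanned q v.
Proof.
by move=> H [x ->]; apply: spanned_sum => l; apply: spannedZ; apply: H.
Qed.

Lemma eliminate_spanned h v : triangular h -> spanned h v -> eliminate h k v = 0.
Proof.
move=> tr [x ->]; elim/big_rec: _ => [|l u _ IH]; first exact: eliminate0.
by rewrite eliminateD IH eliminateZ eliminate_member // scaler0 addr0.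
Qed.

(** A substitute for orthogonality: the norm of each vector is at most 4 times its distance to the
    span of its predecessors. The 4 is the factor of the regression that produces the vectors. *)
Definition conditioned q : Prop := forall l x, (l < k)%N ->
  cnorm (q l) <= 4 * cnorm (q l + \sum_(m < l) x m *: q m).

(** Peel off the last vector. With [v m] the sum of the first [m] terms, conditioning bounds the
    term [x m *: q m] by [4 * cnorm (v m.+1)], so passing from [v m.+1] down to [v m] multiplies the
    norm by at most 5. *)
Lemma coef_conditioned q x l : conditioned q -> (l < k)%N ->
  `|x l| * cnorm (q l) <= 5 ^+ k * cnorm (\sum_(m < k) x m *: q m).
Proof.
move=> cq; pose v l := \sum_(m < l) x m *: q m.
have top m : (m < k)%N -> `|x m| * cnorm (q m) <= 4 * cnorm (v m.+1).
  move=> mk; have [->|x0] := eqVneq (x m) 0.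
    by rewrite normr0 mul0r mulr_ge0 ?cnorm_ge0.
  have := cq m (fun i => (x m)^-1 * x i) mk => H.
  have -> : v m.+1 = x m *: (q m + \sum_(i < m) ((x m)^-1 * x i) *: q i).
    rewrite /v big_ord_recr /= addrC scalerDr scaler_sumr; congr (_ + _).
    by apply: eq_bigr => i _; rewrite scalerA mulrA divff // mul1r.
  by rewrite cnormZ mulrCA ler_wpM2l.
have down m : (m < k)%N -> cnorm (v m) <= 5 * cnorm (v m.+1).
  move=> mk; have -> : v m = v m.+1 - x m *: q m.
    by rewrite /v big_ord_recr /= addrK.
  apply: le_trans (cnormB _ _) _; rewrite cnormZ.
  have := top m mk; lra.
have all j m : (m + j = k)%N -> cnorm (v m) <= 5 ^+ j * cnorm (v k).
  elim: j m => [|j IH] m; first by rewrite addn0 => ->; rewrite expr0 mul1r.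
  move=> E; apply: le_trans (down m _) _; first by lia.
  rewrite exprS -mulrA; apply: ler_wpM2l => //; apply: IH; lia.
move=> lk; apply: le_trans (top l lk) _.
have := all (k - l.+1)%N l.+1 (subnKC lk) => H.
apply: (@le_trans _ _ (5 * (5 ^+ (k - l.+1) * cnorm (v k)))).
  apply: ler_pM; rewrite ?cnorm_ge0 //; lra.
rewrite mulrA -exprS; apply: ler_wpM2r; first exact: cnorm_ge0.
by apply: ler_weXn2l => //; [lra|lia].
Qed.

(** The mesh in direction [q l] has length [cnorm b / (4 k)], so that rounding all [k] coordinates
    moves a point by at most [cnorm b / 4]. The shift by [L] lets natural digits represent negative
    coefficients. *)
Definition grid_point q b (L : nat) (z : nat -> nat) : 'cV[R]_n :=
  b - \sum_(l < k)
    (cnorm b / (4 * k%:R) / cnorm (q l) * ((z l)%:R - L%:R)) *: q l.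

(** The point [v] is within [cnorm b / 4] of [b], and rounding it to the grid adds at most as much.
    The bound on [L] makes the grid wide enough: coordinates times [cnorm (q l)] are at most
    [5 ^ k * (2 * cnorm b)], which is [8 k 5 ^ k] mesh lengths. *)
Lemma grid_halves q b v L : (0 < k)%N -> conditioned q ->
  8 * k%:R * 5 ^+ k < L%:R :> R -> spanned q v -> 4 * cnorm (b - v) <= cnorm b ->
  exists2 z : nat -> nat, (forall l, (l < k)%N -> (z l < 2 * L)%N) &
    cnorm (grid_point q b L z) <= cnorm b / 2.
Proof.
move=> k0 cq hL [x ->] near; set v' := \sum_(l < k) _ in near.
have kp : 0 < k%:R :> R by rewrite ltr0n.
have Lp : 0 < L%:R :> R.
  by apply: le_lt_trans hL; rewrite !mulr_ge0 ?exprn_ge0 // ltW.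
have [b0|bN0] := eqVneq (cnorm b) 0.
  exists (fun=> 0%N).
    by move=> l _; rewrite muln_gt0 /= -(ltr0n R).
  rewrite /grid_point big1 => [|l _]; last by rewrite b0 !mul0r scale0r.
  by rewrite subr0 b0 mul0r.
have bp : 0 < cnorm b by rewrite lt_neqAle eq_sym bN0 cnorm_ge0.
set s := cnorm b / (4 * k%:R).
have sp : 0 < s by rewrite /s divr_gt0 // mulr_gt0.
have Es : s * (4 * k%:R) = cnorm b by rewrite /s divfK // mulf_neq0 // ?gt_eqF.
have nv : cnorm v' <= 2 * cnorm b.
  have -> : v' = b - (b - v') by rewrite opprB addrC subrK.
  by apply: le_trans (cnormB _ _) _; lra.
(* The coordinate of [v] along [q l], in mesh lengths. *)
pose y l := x l * cnorm (q l) / s.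
have yL l : (l < k)%N -> `|y l| < L%:R.
  move=> lk; rewrite /y !normrM normfV (gtr0_norm sp) ltr_pdivrMr //.
  rewrite (ger0_norm (cnorm_ge0 _)); apply: le_lt_trans (coef_conditioned x cq lk) _.
  apply: (@le_lt_trans _ _ (5 ^+ k * (2 * cnorm b))).
    by rewrite ler_wpM2l // exprn_ge0.
  rewrite -Es; rewrite [ltLHS](_ : _ = 8 * k%:R * 5 ^+ k * s); last by ring.
  by rewrite ltr_pM2r.
(* Adding [L] makes the number positive, so truncation is the floor and the rounding error is less
   than 1. *)
pose z l := Num.truncn (y l + L%:R).
have zP l : (l < k)%N -> (z l)%:R <= y l + L%:R < (z l).+1%:R.
  move=> lk; apply: truncn_itv.
  by have := yL l lk; rewrite ltr_norml; lra.
exists z => [l lk|].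
  have /andP[z1 _] := zP l lk; have := yL l lk; rewrite ltr_norml => /andP[_ y2].
  by rewrite -(ltr_nat R) natrM; lra.
have -> : grid_point q b L z = (b - v') + \sum_(l < k) ((y l - ((z l)%:R - L%:R)) * (s / cnorm (q l))) *: q l.
  rewrite /grid_point -/s -addrA; congr (_ + _).
  rewrite /v' -!sumrN -big_split /=; apply: eq_bigr => l _.
  (* For [q l = 0] the coordinate [y l] is lost, but the term vanishes on both sides. *)
  have [q0|q0] := eqVneq (cnorm (q l)) 0.
    by rewrite (cnorm_eq0 q0) !scaler0 oppr0 addr0.
  rewrite -[LHS]scaleNr -[X in _ = X + _]scaleNr -scalerDl; congr (_ *: _).
  have F (a c e f : R) : c != 0 -> e != 0 ->
      - (e / c * f) = - a + (a * c / e - f) * (e / c) by move=> *; field; apply/andP.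
  by rewrite /y; apply: F => //; rewrite gt_eqF.
apply: le_trans (cnormD _ _) _.
have : cnorm (\sum_(l < k) ((y l - ((z l)%:R - L%:R)) * (s / cnorm (q l))) *: q l) <= k%:R * s.
  apply: le_trans (cnorm_sum _ _) _.
  have -> : k%:R * s = \sum_(l < k) s by rewrite sumr_const card_ord mulr_natl.
  apply: ler_sum => l _; rewrite cnormZ normrM.
  have [q0|q0] := eqVneq (cnorm (q l)) 0; first by rewrite q0 mulr0 ltW.
  have qp : 0 < cnorm (q l) by rewrite lt_neqAle eq_sym q0 cnorm_ge0.
  rewrite (ger0_norm (_ : 0 <= s / cnorm (q l))); last by rewrite divr_ge0 // ltW.
  rewrite -mulrA divfK // -[leRHS]mul1r ler_wpM2r ?(ltW sp) //.
  have /andP[z1] := zP l (ltn_ord l); rewrite -natr1 ler_norml; lra.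
lra.
Qed.

(** * Refinement by repeated grid steps *)

Definition grid_step q (L : nat) b b' : Prop :=
  [/\ spanned q (b - b'), cnorm b' <= cnorm b &
  forall z : nat -> nat, (forall l, (l < k)%N -> (z l < 2 * L)%N) ->
    cnorm b' <= cnorm (grid_point q b L z)].

(** Once the residual is within a factor 4 of the distance to [v] it stays so, because steps never
    increase the norm; until then every step halves it. *)
Lemma iter_grid_step q L (bs : nat -> 'cV[R]_n) t v :
  (0 < k)%N -> conditioned q -> 8 * k%:R * 5 ^+ k < L%:R :> R ->
  (forall i, (i < t)%N -> grid_step q L (bs i) (bs i.+1)) -> spanned q v ->
  spanned q (bs 0 - bs t) /\
  (cnorm (bs t) <= 4 * cnorm (bs 0 - v) \/ cnorm (bs t) <= cnorm (bs 0) / 2 ^+ t).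
Proof.
move=> k0 cq hL; elim: t => [|t IH] st sv.
  by rewrite subrr expr0 divr1; split; [exact: spanned0|right].
have [s0 dist] := IH (fun i it => st i (ltnW it)) sv.
have [sst le_st best] := st t (leqnn _).
split; first by rewrite -(subrK (bs t) (bs 0)) -addrA; apply: spannedD.
case: dist => [H|H]; first by left; apply: le_trans le_st H.
have [near|far] := leP (4 * cnorm (bs 0 - v)) (cnorm (bs t)); last first.
  by left; apply: le_trans le_st (ltW far).
(* Relative to the current residual, the target is [v] minus what has already been subtracted. *)
right; have [|z zL zle] := @grid_halves q (bs t) (v - (bs 0 - bs t)) L k0 cq hL (spannedB sv s0).
  by rewrite opprB addrA [bs t + _]addrC subrK.
apply: le_trans (best z zL) _; apply: le_trans zle _.
rewrite exprSr invfM mulrA; lra.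
Qed.

Definition near_opt h b b' : Prop := spanned h (b - b') /\
  forall v, spanned h v -> cnorm b' <= 4 * cnorm (b - v).

Lemma spanned_eliminate h b : spanned h (b - eliminate h k b).
Proof. by exists (elim_coef h b); rewrite eliminateE opprB addrC subrK. Qed.

(** Elimination is linear and kills the span, so the start [eliminate h k b] equals
    [eliminate h k (b - v)] and has norm at most [(1 + n) ^ k * cnorm (b - v)], for every [v] at
    once. Since [1 + n <= 2 ^ n], halving [n k] times removes this factor. *)
Lemma near_opt_refine h q L (bs : nat -> 'cV[R]_n) b :
  (0 < k)%N -> triangular h -> conditioned q -> 8 * k%:R * 5 ^+ k < L%:R :> R ->
  (forall v, spanned h v <-> spanned q v) ->
  bs 0%N = eliminate h k b ->
  (forall i, (i < n * k)%N -> grid_step q L (bs i) (bs i.+1)) ->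
  near_opt h b (bs (n * k)%N).
Proof.
move=> k0 tr cq hL hq b0 steps.
have [s0 _] := iter_grid_step k0 cq hL steps (spanned0 q).
have sE := spanned_eliminate h b.
split.
  rewrite -(subrK (bs 0%N) b) -addrA; apply: spannedD; first by rewrite b0.
  exact/hq.
move=> v sv.
have [_] := iter_grid_step k0 cq hL steps ((hq _).1 (spannedB sv sE)).
have -> : bs 0%N - (v - (b - eliminate h k b)) = b - v.
  by rewrite b0 opprB addrA [_ + (b - _)]addrC subrK.
case=> // le_half; apply: le_trans le_half _.
have E : eliminate h k b = eliminate h k (b - v).
  rewrite eliminateD -scaleN1r eliminateZ (eliminate_spanned tr sv).
  by rewrite scaler0 addr0.
have p2 : 0 < 2 ^+ (n * k) :> R by rewrite exprn_gt0.
rewrite ler_pdivrMr // b0 E; apply: le_trans (cnorm_eliminate _ _ _) _.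
rewrite mulrAC; apply: ler_wpM2r; first exact: cnorm_ge0.
apply: (@le_trans _ _ (2 ^+ (n * k))); last by rewrite -[leLHS]mul1r ler_pM2r //; lra.
rewrite exprM lerXn2r ?nnegrE ?exprn_ge0 ?addr_ge0 ?ler0n //.
by rewrite addrC natr1 -natrX ler_nat ltn_expl.
Qed.

(** After [j] columns, [h] serves to eliminate and [q] to search the grid, over one common span.
    Slots from [j] on are zero, so that every routine can run over all [k] slots during the
    construction. *)
Record basis_inv (a h q : nat -> 'cV[R]_n) (j : nat) : Prop := BasisInv {
  inv_triangular : triangular h;
  inv_conditioned : conditioned q;
  inv_zero_h : forall l, (l < k)%N -> (j <= l)%N -> h l = 0;
  inv_zero_q : forall l, (l < k)%N -> (j <= l)%N -> q l = 0;
  inv_hq : forall l, (l < k)%N -> spanned q (h l);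
  inv_qh : forall l, (l < k)%N -> spanned h (q l);
  inv_a : forall l, (l < j)%N -> spanned h (a l) }.

Lemma basis_inv_span a h q j v : basis_inv a h q j -> spanned h v <-> spanned q v.
Proof.
by case=> _ _ _ _ hq qh _; split; apply: spanned_trans.
Qed.

Lemma basis_inv0 a h q :
  (forall l, (l < k)%N -> h l = 0) -> (forall l, (l < k)%N -> q l = 0) ->
  basis_inv a h q 0.
Proof.
move=> h0 q0; split => // [m l ml lk|l x lk|l lk _|l lk _|l lk|l lk].
- by rewrite h0 // entry0 mul0r.
- by rewrite q0 // cnorm0 mulr_ge0 ?cnorm_ge0.
- exact: h0.
- exact: q0.
- by rewrite h0 //; apply: spanned0.
- by rewrite q0 //; apply: spanned0.
Qed.

(** The new [h] vector is the eliminated column, the new [q] vector its near-optimal residual. Both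
    differ from [a j] by elements of the old span, so the two spans still agree. *)
Lemma basis_inv_step a h q h' q' j b : (j < k)%N -> basis_inv a h q j ->
  near_opt h (a j) b ->
  h' j = eliminate h k (a j) -> (forall l, (l < k)%N -> l != j -> h' l = h l) ->
  q' j = b -> (forall l, (l < k)%N -> l != j -> q' l = q l) ->
  basis_inv a h' q' j.+1.
Proof.
move=> jk BI [sb nb] h'j h'l q'j q'l; have [tr cq h0 q0 hq qh ha] := BI.
have hh' v : spanned h v -> spanned h' v.
  apply: spanned_trans => l lk; have [->|lj] := eqVneq l j.
    by rewrite h0 //; apply: spanned0.
  by rewrite -h'l //; apply: spanned_member.
have qq' v : spanned q v -> spanned q' v.
  apply: spanned_trans => l lk; have [->|lj] := eqVneq l j.
    by rewrite q0 //; apply: spanned0.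
  by rewrite -q'l //; apply: spanned_member.
have sE : spanned h (a j - h' j) by rewrite h'j; apply: spanned_eliminate.
have sD : spanned h (h' j - b).
  have -> : h' j - b = (a j - b) - (a j - h' j) by rewrite opprB [RHS]addrC subrKA.
  exact: spannedB.
split.
- move=> m l ml lk; case: (ltngtP l j) => lj.
  + rewrite !h'l; [exact: tr|lia..].
  + by rewrite [h' l]h'l ?h0 ?entry0 ?mul0r //; lia.
  + subst l; rewrite h'j [h' m]h'l; [|lia..].
    by apply: entry_eliminate => //; lia.
- move=> l x lk; case: (ltngtP l j) => lj.
  + rewrite q'l; [|lia..]; apply: le_trans (cq l x lk) _.
    rewrite (eq_bigr (fun m : 'I_l => x m *: q' m)) // => m _.
    by rewrite q'l //; have := ltn_ord m; lia.
  + by rewrite q'l ?q0 ?cnorm0 ?mulr_ge0 ?cnorm_ge0 //; lia.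
  + subst l; rewrite q'j; set S := \sum_(m < j) _.
    have sS : spanned h S.
      apply: spanned_sum => m; apply: spannedZ; have := ltn_ord m => mj.
      by rewrite q'l; [apply: qh|..]; lia.
    (* Adding earlier vectors to [b] gives another residual of [a j] modulo the old span, so the
       near-optimality of [b] is exactly the conditioning inequality. *)
    have -> : b + S = a j - ((a j - b) - S) by rewrite !opprB [RHS]addrC -addrA subrK addrC.
    by apply: nb; apply: spannedB.
- by move=> l lk jl; rewrite h'l ?h0 //; lia.
- by move=> l lk jl; rewrite q'l ?q0 //; lia.
- move=> l lk; have [->|lj] := eqVneq l j; last first.
    by rewrite h'l //; apply: qq'; apply: hq.
  rewrite -(subrK b (h' j)); apply: spannedD.
    exact/qq'/(basis_inv_span _ BI).
  by rewrite -q'j; apply: spanned_member.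
- move=> l lk; have [->|lj] := eqVneq l j; last first.
    by rewrite q'l //; apply: hh'; apply: qh.
  rewrite q'j; have -> : b = h' j - (h' j - b) by rewrite opprB addrC subrK.
  by apply: spannedB; [apply: spanned_member|apply: hh'].
- move=> l; rewrite ltnS leq_eqVlt => /orP[/eqP->|lj]; last exact/hh'/ha.
  rewrite -(subrK (h' j) (a j)); apply: spannedD; first exact: hh'.
  exact: spanned_member.
Qed.

End L1Regression.

(** Allows one integer counter to enumerate all tuples, both of grid digits and of columns. *)
Lemma exists_digits (G k : nat) (z : nat -> nat) :
  (forall l, l < k -> z l < G)%N ->
  exists2 t, (t < G ^ k)%N & forall l, (l < k -> (t %/ G ^ l) %% G = z l)%N.
Proof.
elim: k z => [|k IH] z zG; first by exists 0%N.
have [t tG tz] := IH (fun l => z l.+1) (fun l lk => zG l.+1 lk).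
have G0 : (0 < G)%N by apply: leq_ltn_trans (zG 0%N _).
exists (t * G + z 0%N)%N.
  by rewrite expnSr; have := zG 0%N isT; nia.
case=> [|l] lk; first by rewrite expn0 divn1 modnMDl modn_small // zG.
by rewrite expnS divnMA divnMDl // (divn_small (zG _ _)) // addn0 tz.
Qed.

(** * Column subsets by Cramer's rule *)

Section ColumnSubset.
Variables (R : realType) (n d : nat).

Lemma det_replace_col (r : nat) (V : 'M[R]_(r, d)) (f : 'I_r -> 'I_d) i j :
  \det (colsub [eta f with i |-> j] V) = (\adj (colsub f V) *m V) i j.
Proof.
rewrite (expand_det_col _ i) !mxE; apply: eq_bigr => l _.
rewrite !mxE /= eqxx mulrC /cofactor; congr (_ * \det _ * _).
apply/matrixP => a b; rewrite !mxE /=.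
by rewrite eq_sym (negbTE (neq_lift _ _)).
Qed.

(** Exchanging [f i] for [j] multiplies the determinant by [M i j] and the product of weights by
    [w j / w (f i)]; at a maximum of the quotient no exchange is a gain. *)
Lemma exists_col_basis (r : nat) (V : 'M[R]_(r, d)) (w : 'I_d -> R) :
  row_free V -> (forall j, 0 < w j) ->
  exists (f : 'I_r -> 'I_d) (M : 'M[R]_(r, d)),
    colsub f V *m M = V /\ forall i j, `|M i j| * w (f i) <= w j.
Proof.
move=> fV w0.
have fVT : row_full V^T by rewrite /row_full mxrank_tr.
pose f0 := fullrankfun fVT.
pose F (f : {ffun 'I_r -> 'I_d}) := `|\det (colsub f V)| / \prod_i w (f i).
have P0 (f : 'I_r -> 'I_d) : 0 < \prod_i w (f i) by apply: prodr_gt0.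
case: (@Order.TotalTheory.arg_maxP _ _ _ f0 xpredT F isT) => f _ fmax.
(* Some choice has a nonzero determinant because [V] has full row rank; hence so does the maximiser,
   whose submatrix is therefore invertible. *)
have d0 : \det (colsub f0 V) != 0.
  have := fullrowsub_unit fVT; rewrite -unitmx_tr unitmxE unitfE.
  by congr (\det _ != 0); apply/matrixP => a b; rewrite !mxE.
have df : \det (colsub f V) != 0.
  have : 0 < F f0 by rewrite divr_gt0 // normr_gt0.
  move=> /lt_le_trans/(_ (fmax f0 isT)); rewrite /F pmulr_lgt0 ?invr_gt0 //.
  by rewrite normr_gt0.
have uf : colsub f V \in unitmx by rewrite unitmxE unitfE.
exists f, (invmx (colsub f V) *m V); split; first by rewrite mulKVmx.
move=> i j; set M := invmx _ *m V.
pose g : {ffun 'I_r -> 'I_d} := finfun [eta f with i |-> j].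
have dg : \det (colsub g V) = \det (colsub f V) * M i j.
  rewrite (_ : colsub g V = colsub [eta f with i |-> j] V); last first.
    by apply/matrixP => a b; rewrite !mxE ffunE.
  rewrite /M /invmx uf -scalemxAl [X in _ * X]mxE mulrA divff // mul1r.
  exact: det_replace_col.
have Pf : \prod_l w (f l) = w (f i) * \prod_(l | l != i) w (f l) by rewrite (bigD1 i).
have Pg : \prod_l w (g l) = w j * \prod_(l | l != i) w (f l).
  rewrite (bigD1 i) //= ffunE /= eqxx; congr (_ * _).
  by apply: eq_bigr => l li; rewrite ffunE /= (negbTE li).
have : F g <= F f := fmax g isT; rewrite /F dg normrM Pf Pg.
have Q0 : 0 < \prod_(l | l != i) w (f l) by apply: prodr_gt0.
rewrite -!mulrA ler_pM2l ?normr_gt0 // !invfM.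
rewrite mulrA ler_pM2r ?invr_gt0 // ler_pdivrMr //.
by rewrite mulrC ler_pdivlMr // mulrC.
Qed.

(** Column [j] of [B] is a combination of the chosen columns of [B]; taking those of [A] instead
    costs [|M i j|] times the error of column [f i], at most [w j], for each of at most [k] indices.
    Weights must be positive while errors may vanish, so each error is padded by [e'], which
    produces the slack [e]. *)
Lemma exists_col_subset (k : nat) (A B : 'M[R]_(n, d)) (e : R) :
  (0 < d)%N -> (\rank B <= k)%N -> 0 < e ->
  exists (f : nat -> 'I_d) (X : nat -> 'I_d -> R),
    \sum_j cnorm (col j A - \sum_(l < k) X l j *: col (f l) A)
      <= (k%:R + 1) * l1norm (B - A) + e.
Proof.
move=> d0 rk e0; set D := B - A.
set r := \rank B in rk.
pose e' := e / ((k%:R + 1) * d%:R).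
have e'0 : 0 < e' by rewrite divr_gt0 // mulr_gt0 ?ltr0n // ltr_wpDl.
pose w j := cnorm (col j D) + e'.
have w0 j : 0 < w j by rewrite ltr_wpDl ?cnorm_ge0.
have [f [M [VM wM]]] := exists_col_basis (row_base_free B) w0.
(* If the rank is below [k], the list is filled up with an arbitrary column, used with coefficient
   0. *)
pose f' (l : nat) := if insub l is Some i then f i else Ordinal d0.
pose X (l : nat) j := if insub l is Some i then M i j else 0.
exists f', X.
have colB j : \sum_(l < k) X l j *: col (f' l) A
    = col j B - \sum_(i < r) M i j *: col (f i) D.
  have -> : col j B = \sum_(i < r) M i j *: col (f i) B.
    rewrite -{1}(mulmx_base B) -{1}VM; apply/matrixP => a b.
    rewrite ord1 mxE mulmxA mxE summxE; apply: eq_bigr => i _.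
    rewrite [RHS]mxE mulrC; congr (_ * _).
    transitivity ((col_base B *m row_base B) a (f i)); last by rewrite mulmx_base mxE.
    by rewrite !mxE; apply: eq_bigr => l _; rewrite !mxE.
  rewrite -sumrB (bigID (fun l : 'I_k => (l < r)%N)) /= [X in _ + X]big1 => [|l]; last first.
    by rewrite /X; case: insubP => [i -> //|_ _]; rewrite scale0r.
  rewrite addr0 -(big_ord_widen k (fun l => X l j *: col (f' l) A) rk).
  apply: eq_bigr => i _; rewrite /X /f' !valK -scalerBr; congr (_ *: _).
  by apply/matrixP => a b; rewrite !mxE opprB addrCA subrr addr0.
have colerr j : cnorm (col j A - \sum_(l < k) X l j *: col (f' l) A)
    <= cnorm (col j D) + k%:R * w j.
  rewrite colB opprB addrCA.
  have -> : col j A - col j B = - col j D.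
    by apply/matrixP => a b; rewrite !mxE opprB.
  apply: le_trans (cnormB _ _) _; rewrite addrC lerD2l.
  apply: le_trans (cnorm_sum _ _) _.
  apply: (@le_trans _ _ (\sum_(i < r) w j)); last first.
    by rewrite sumr_const card_ord -[w j *+ _]mulr_natl ler_wpM2r ?(ltW (w0 j)) // ler_nat.
  apply: ler_sum => i _; rewrite cnormZ; apply: le_trans (wM i j).
  by rewrite ler_wpM2l // lerDl ltW.
apply: le_trans (ler_sum _ (fun j _ => colerr j)) _.
have -> : l1norm D = \sum_j cnorm (col j D).
  rewrite /l1norm exchange_big; apply: eq_bigr => j _.
  by rewrite /cnorm; apply: eq_bigr => i _; rewrite !mxE.
rewrite big_split /= -mulr_sumr big_split /= sumr_const card_ord -[e' *+ d]mulr_natl.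
have k1 : k%:R + 1 != 0 :> R by rewrite gt_eqF // ltr_wpDl.
have dn : d%:R != 0 :> R by rewrite pnatr_eq0 -lt0n.
have E : (k%:R + 1) * (d%:R * e') = e by rewrite mulrA mulrC /e' divfK ?mulf_neq0.
have : 0 <= d%:R * e' by rewrite mulr_ge0 // ltW.
rewrite -E; lra.
Qed.

End ColumnSubset.

(** * The program and its correctness *)

(** Constant registers: [i[0..2] = n, d, k], [i[5] = n d], [i[6] = 2 L] (grid
    values per coordinate), [i[7] = 0], [i[8] = (2 L) ^ k], [i[9] = d ^ k],
    [i[10] = n k], [i[11] = k d], [i[12] = n k + k d]; [f[0] = 0], [f[6] = L],
    [f[7] = 4 k], [f[14] = 1].  The arrays [aH] and [aQ] hold the eliminated and
    the conditioned basis, column by column; [aB] the current residual, [aC] and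
    [aX] the current and the best grid point; [aE] the elimination
    coefficients; [aV] the coefficients of all columns, and [aO] the best pair
    [(U, V)] so far, in the format of the output. *)
Local Notation aH := 0%N (only parsing).
Local Notation aQ := 1%N (only parsing).
Local Notation aB := 2%N (only parsing).
Local Notation aX := 3%N (only parsing).
Local Notation aC := 4%N (only parsing).
Local Notation aE := 5%N (only parsing).
Local Notation aV := 6%N (only parsing).
Local Notation aO := 7%N (only parsing).

Definition Norm (m p : nat) : com :=
  Reg (FConst 3 0) ;;
  For 20 0 (Reg (IAdd 21 p 20) ;; Ld 1 m 21 ;; Reg (FSub 2 0 1) ;;
    IfF 0 1 (Reg (FAdd 3 3 1)) (Reg (FAdd 3 3 2))).

Definition Axpy (m src p : nat) : com :=
  For 20 0 (Reg (IAdd 21 p 20) ;; Ld 1 src 21 ;; Reg (FMul 1 4 1) ;;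
    Ld 2 m 20 ;; Reg (FSub 2 2 1) ;; St m 20 2).

Definition Copy (m pd src ps : nat) : com :=
  For 20 0 (Reg (IAdd 21 ps 20) ;; Ld 1 src 21 ;; Reg (IAdd 21 pd 20) ;;
    St m 21 1).

Definition Argmax (p : nat) : com :=
  Reg (FConst 5 0) ;; Reg (IConst 22 0) ;;
  For 20 0 (Reg (IAdd 21 p 20) ;; Ld 1 aH 21 ;; Reg (FSub 2 0 1) ;;
    IfF 1 2 (Reg (FAdd 1 2 0)) Skip ;;
    IfF 1 5 Skip (Reg (FAdd 5 1 0) ;; Reg (IAdd 22 20 7))).

Definition PivotCoef : com :=
  Ld 1 aB 22 ;; Reg (IAdd 21 24 22) ;; Ld 2 aH 21 ;; Reg (FDiv 4 1 2) ;;
  St aE 23 4.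

Definition Eliminate : com :=
  Reg (IConst 24 0) ;;
  For 23 2 (Argmax 24 ;; PivotCoef ;; Axpy aB aH 24 ;; Reg (IAdd 24 24 0)).

(** Division by repeated subtraction. The number of rounds is a register [lim] fixed in advance; the
    quotient replaces [u], the remainder goes to [i[32]]. *)
Definition Divmod (u g lim : nat) : com :=
  Reg (IConst 30 0) ;;
  For 31 lim (IfI g u
    (Reg (ISub u u g) ;; Reg (IConst 32 1) ;; Reg (IAdd 30 30 32)) Skip) ;;
  Reg (IAdd 32 u 7) ;; Reg (IAdd u 30 7).

(** Turns the integer digit into a real by counting, as no instruction converts. *)
Definition Digit : com :=
  Reg (FSub 11 0 6) ;; For 31 6 (IfI 32 31 Skip (Reg (FAdd 11 11 14))).

Definition GridPoint : com :=
  Copy aC 7 aB 7 ;; Reg (IAdd 27 26 7) ;; Reg (IConst 29 0) ;;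
  For 28 2 (Divmod 27 6 8 ;; Norm aQ 29 ;; Reg (FDiv 4 9 3) ;; Digit ;;
    Reg (FMul 4 4 11) ;; Axpy aC aQ 29 ;; Reg (IAdd 29 29 0)).

(** The search starts from the current residual as best candidate, so that the norm cannot
    increase. *)
Definition GridStep : com :=
  Norm aB 7 ;; Reg (FDiv 9 3 7) ;; Copy aX 7 aB 7 ;; Reg (FAdd 10 3 0) ;;
  For 26 8 (GridPoint ;; Norm aC 7 ;;
    IfF 3 10 (Reg (FAdd 10 3 0) ;; Copy aX 7 aC 7) Skip) ;;
  Copy aB 7 aX 7.

Definition Refine : com := For 25 10 GridStep.

Definition LoadCol (c : nat) : com :=
  Reg (IAdd 38 c 7) ;;
  For 20 0 (Reg (FLoad 1 38) ;; St aB 20 1 ;; Reg (IAdd 38 38 1)).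

(** Removes the basis of the previous choice: unfilled slots have to be zero vectors. *)
Definition Clear : com := For 20 10 (St aH 20 0 ;; St aQ 20 0).

Definition Basis : com :=
  Clear ;; Reg (IAdd 34 33 7) ;; Reg (IConst 36 0) ;;
  For 35 2 (Divmod 34 1 9 ;; LoadCol 32 ;; Eliminate ;; Copy aH 36 aB 7 ;;
    Refine ;; Copy aQ 36 aB 7 ;; Reg (IAdd 36 36 0)).

Definition Residue : com :=
  Reg (IAdd 38 35 7) ;;
  For 20 0 (Reg (FLoad 1 38) ;; Ld 2 aB 20 ;; Reg (FSub 1 1 2) ;; St aB 20 1 ;;
    Reg (IAdd 38 38 1)).

Definition StoreCoefs : com :=
  Reg (IAdd 38 35 7) ;;
  For 20 2 (Ld 1 aE 20 ;; St aV 38 1 ;; Reg (IAdd 38 38 1)).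

(** Refinement changes the residual without recording coefficients. They are recovered afterwards:
    the column minus its residual lies in the span of the [aH] vectors, and a second elimination
    reads off its coordinates. *)
Definition Solve : com :=
  Reg (FConst 12 0) ;;
  For 35 1 (LoadCol 35 ;; Eliminate ;; Refine ;; Norm aB 7 ;;
    Reg (FAdd 12 12 3) ;; Residue ;; Eliminate ;; StoreCoefs).

Definition RecordU : com :=
  Reg (IConst 36 0) ;;
  For 20 0 (Reg (IAdd 38 20 7) ;;
    For 23 2 (Ld 1 aH 38 ;; St aO 36 1 ;; Reg (IAdd 38 38 0) ;;
      Reg (IConst 21 1) ;; Reg (IAdd 36 36 21))).

Definition RecordV : com :=
  For 20 11 (Reg (IAdd 21 10 20) ;; Ld 1 aV 20 ;; St aO 21 1).

(* The first line makes sure that the first choice of columns is accepted. *)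
Definition Keep : com :=
  IfI 33 7 (Reg (FAdd 13 12 0)) Skip ;;
  IfF 12 13 (Reg (FAdd 13 12 0) ;; RecordU ;; RecordV) Skip.

Definition SearchAll : com := For 33 9 (Basis ;; Solve ;; Keep).

Definition Output : com := For 20 12 (Ld 1 aO 20 ;; Wr 20 1).

Definition InitBase : com := For 20 0 (Reg (IAdd 5 5 1)).

Definition InitSizes : com :=
  For 20 0 (Reg (IAdd 10 10 2)) ;; For 20 2 (Reg (IAdd 11 11 1)) ;;
  Reg (IAdd 12 10 11) ;;
  Reg (IConst 6 32) ;;
  For 20 2 (Reg (IAdd 6 6 6) ;; Reg (IAdd 6 6 6) ;; Reg (IAdd 6 6 6) ;;
    Reg (IAdd 6 6 6)) ;;
  Reg (FConst 6 16) ;; Reg (FConst 1 16) ;; For 20 2 (Reg (FMul 6 6 1)) ;;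
  Reg (FConst 1 4) ;; For 20 2 (Reg (FAdd 7 7 1)) ;; Reg (FConst 14 1).

Definition Power (x b : nat) : com :=
  Reg (IConst x 1) ;;
  For 20 2 (Reg (IConst 21 0) ;; For 22 b (Reg (IAdd 21 21 x)) ;;
    Reg (IAdd x 21 7)).

Definition Setup : com := InitBase ;; InitSizes ;; Power 9 1.

(** [Power 8 6] is kept apart from [Setup], where its loop limit [i[6]] is computed: the time bound
    needs the limits of a piece to be constant in that piece. *)
Definition Prog : com := Setup ;; Power 8 6 ;; SearchAll ;; Output.

Local Opaque incr reset.

Definition stepE := (den_IConst, den_IAdd, den_ISub, den_FConst,
  den_FAdd, den_FSub, den_FMul, den_FDiv, den_FLoad, den_Ld).

Ltac dstep := rewrite den_Seq ?stepE /upd /=.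

Lemma divmod_step U G q v t : (0 < G)%N -> (v + q * G = U)%N ->
  q = minn t (U %/ G) -> (G <= v)%N ->
  q.+1 = minn t.+1 (U %/ G) /\ ((v - G) + q.+1 * G = U)%N.
Proof.
move=> G0 e qE Gv; split; last by rewrite mulSn addnA subnK.
have : (q < U %/ G)%N by rewrite leq_divRL // mulSn -e leq_add2r.
lia.
Qed.

Lemma divmod_stop U G q v t : (v + q * G = U)%N ->
  q = minn t (U %/ G) -> (v < G)%N -> q = minn t.+1 (U %/ G).
Proof.
move=> e qE vG; have : (U %/ G)%N = q.
  by rewrite -e addnC divnMDl ?divn_small ?addn0 //; apply: leq_ltn_trans vG.
lia.
Qed.

Lemma row_major_eq (d l j l' j' : nat) : (j < d)%N -> (j' < d)%N ->
  (l * d + j == l' * d + j')%N = (l == l') && (j == j').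
Proof.
move=> jd jd'; apply/eqP/andP => [E|[/eqP-> /eqP->]//].
have d0 : (0 < d)%N by apply: leq_ltn_trans jd.
have := congr1 (modn^~ d) E; rewrite !modnMDl !modn_small // => ->.
have := congr1 (divn^~ d) E; rewrite !divnMDl // !divn_small // !addn0 => ->.
by rewrite !eqxx.
Qed.

(** * Correctness of the vector routines *)

Section Correctness.
Variables (R : realType) (n d k : nat) (A : 'M[R]_(n, d)).
Hypotheses (n_gt0 : (0 < n)%N) (d_gt0 : (0 < d)%N) (k_gt0 : (0 < k)%N).
Implicit Types (s : st R).

(** A number above [8 k 5 ^ k], because [k < 2 ^ k] and [10 <= 16]. As a power of 16 it is easily
    built by the program, and [2 * gridL] is the power [2 ^ (4 k + 5)]. *)
Definition gridL : nat := (16 ^ k.+1)%N.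

Record consts s : Prop := Consts {
  ir0 : ir s 0 = n; ir1 : ir s 1 = d; ir2 : ir s 2 = k;
  ir5 : ir s 5 = (n * d)%N; ir6 : ir s 6 = (2 * gridL)%N; ir7 : ir s 7 = 0%N;
  ir8 : ir s 8 = ((2 * gridL) ^ k)%N; ir9 : ir s 9 = (d ^ k)%N;
  ir10 : ir s 10 = (n * k)%N; ir11 : ir s 11 = (k * d)%N;
  ir12 : ir s 12 = (n * k + k * d)%N;
  fr0 : fr s 0 = 0; fr6 : fr s 6 = gridL%:R; fr7 : fr s 7 = 4 * k%:R;
  fr14 : fr s 14 = 1;
  rawA : forall (i : 'I_n) (j : 'I_d), fm s (i * d + j)%N = A i j }.

Definition iconsts := [:: 0; 1; 2; 5; 6; 7; 8; 9; 10; 11; 12]%N.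
Definition fconsts := [:: 0; 6; 7; 14]%N.

Definition keeps (wi wf : seq nat) : bool :=
  all (fun r => r \notin wi) iconsts && all (fun r => r \notin wf) fconsts.

Lemma raw_lt (i : 'I_n) (j : 'I_d) : (i * d + j < n * d)%N.
Proof. have := ltn_ord i; have := ltn_ord j; nia. Qed.

Lemma consts_same wi wf wa s s' : keeps wi wf -> same wi wf wa s s' ->
  consts s -> consts s'.
Proof.
move=> /andP[/allP ki /allP kf] [si sf _ sm] C.
split; rewrite ?si ?sf; try by [apply: ki|apply: kf|case: C].
by move=> i j; rewrite sm ?(rawA C) // (ir5 C) raw_lt.
Qed.

Lemma consts_den c s : clean c -> keeps (wri c) (wrf c) -> consts s -> consts (den c s).
Proof. by move=> /and3P[_ sc c5] kc; apply: consts_same kc (same_den s sc c5). Qed.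

Definition vec s (m p : nat) : 'cV[R]_n := \col_i fa s m (p + i)%N.

Lemma eq_vec s s' m p : (forall i, (i < n)%N -> fa s' m (p + i) = fa s m (p + i)) -> vec s' m p = vec s m p.
Proof. by move=> H; apply/matrixP => i j; rewrite !mxE H. Qed.

Lemma vec_den c s m p : array_safe c -> 5 \notin wri c -> (m < 8)%N -> m \notin wra c ->
  vec (den c s) m p = vec s m p.
Proof. by move=> *; apply: eq_vec => i _; rewrite fa_den. Qed.

Lemma cnorm_vec s m p : cnorm (vec s m p) = \sum_(0 <= i < n) `|fa s m (p + i)|.
Proof. by rewrite big_mkord; apply: eq_bigr => i _; rewrite mxE. Qed.

Lemma entry_vec s m p i : (i < n)%N -> entry (vec s m p) i = fa s m (p + i).
Proof. by move=> lt; rewrite (entry_ord _ (Ordinal lt)) mxE. Qed.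

Lemma Norm_spec m p s : p \notin [:: 3; 4; 20; 21]%N -> (m < 8)%N -> consts s ->
  fr (den (Norm m p) s) 3 = cnorm (vec s m (ir s p)).
Proof.
rewrite !inE !negb_or => /and4P[p3 p4 p20 p21] m8 C.
rewrite /Norm den_Seq den_FConst; set s0 := State _ _ _.
pose Inv t s' := fr s' 3 = \sum_(0 <= i < t) `|fa s m (ir s p + i)|.
rewrite cnorm_vec -(ir0 C).
apply: (@for_inv _ Inv 20 0 _ s0) => //.
  by rewrite /Inv big_geq // fr_reset /= updE.
move=> t s' lt_t x [si sf sa sm]; rewrite /Inv => I.
rewrite big_nat_recr // -I fr_incr; do !dstep; rewrite den_IfF !stepE /upd /= -!/(fa s' m _).
have -> : fa s' m (ir s' p + ir s' 20) = fa s m (ir s p + t).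
  by rewrite sa // x si // !inE !negb_or p20 p4 p21 p3.
rewrite sf // [fr s0 0](fr0 C); case: ifP => [H|/negbT] /=; first by rewrite ger0_norm.
by rewrite -ltNge => H; rewrite ltr0_norm // sub0r.
Qed.

Lemma Axpy_spec m src p s : p \notin [:: 3; 4; 20; 21]%N ->
  (m < 8)%N -> (src < 8)%N -> m != src -> consts s ->
  vec (den (Axpy m src p) s) m 0 = vec s m 0 - fr s 4 *: vec s src (ir s p).
Proof.
rewrite !inE !negb_or => /and4P[p3 p4 p20 p21] m8 src8 msrc C.
pose Inv t s' := forall i, fa s' m i =
  if (i < t)%N then fa s m i - fr s 4 * fa s src (ir s p + i) else fa s m i.
suff : Inv (ir s 0) (den (Axpy m src p) s).
  by rewrite (ir0 C) => I; apply/matrixP => i j; rewrite !mxE I ltn_ord.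
apply: (@for_inv _ Inv 20 0) => //.
  by rewrite /clean /= m8.
move=> t s' lt_t x [si sf sa sm] I i.
rewrite fa_incr; last by [].
do !dstep; rewrite fa_St; [|by []..]; rewrite eqxx /= -!/(fa s' _ _) x.
rewrite [fa s' src _]sa //; last by rewrite /= inE eq_sym.
rewrite si; last by rewrite !inE !negb_or p20 p4 p21 p3.
rewrite !I sf // ltnS ltnn; by case: (ltngtP i t) => // ->.
Qed.

Lemma Copy_spec m pd src ps s i :
  ps \notin [:: 3; 4; 20; 21]%N -> pd \notin [:: 3; 4; 20; 21]%N ->
  (m < 8)%N -> (src < 8)%N -> m != src -> consts s ->
  fa (den (Copy m pd src ps) s) m i =
    if (ir s pd <= i < ir s pd + n)%N then fa s src (ir s ps + (i - ir s pd))
    else fa s m i.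
Proof.
rewrite !inE !negb_or => /and4P[p3 p4 p20 p21] /and4P[q3 q4 q20 q21] m8 src8 msrc C.
pose Inv t s' := forall i, fa s' m i =
  if (ir s pd <= i < ir s pd + t)%N then fa s src (ir s ps + (i - ir s pd))
  else fa s m i.
suff : Inv (ir s 0) (den (Copy m pd src ps) s) by rewrite (ir0 C) => ->.
apply: (@for_inv _ Inv 20 0) => //.
- by rewrite /clean /= m8.
- by move=> j; rewrite fa_reset // addn0; case: ifP => //; lia.
move=> t s' lt_t x [si sf sa sm] I j.
rewrite fa_incr; last by [].
do !dstep; rewrite fa_St; [|by []..]; rewrite eqxx /= -!/(fa s' _ _) x.
rewrite (negbTE q3) (negbTE q4) (negbTE q21).
rewrite [fa s' src _]sa //; last by rewrite /= inE eq_sym.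
rewrite !si ?inE ?negb_or ?p20 ?p4 ?p21 ?p3 ?q20 ?q4 ?q21 ?q3 //.
rewrite !I; case: eqP => [->|ne].
  by rewrite ifT; [congr (fa _ _ _)|]; lia.
by congr (if _ then _ else _); lia.
Qed.

Lemma vec_Copy m pd src ps s :
  ps \notin [:: 3; 4; 20; 21]%N -> pd \notin [:: 3; 4; 20; 21]%N ->
  (m < 8)%N -> (src < 8)%N -> m != src -> consts s ->
  vec (den (Copy m pd src ps) s) m (ir s pd) = vec s src (ir s ps).
Proof.
move=> *; apply/matrixP => i j; rewrite !mxE Copy_spec // leq_addr ltn_add2l.
by rewrite ltn_ord addKn.
Qed.

Lemma vec_Copy0 m src s : (m < 8)%N -> (src < 8)%N -> m != src -> consts s ->
  vec (den (Copy m 7 src 7) s) m 0 = vec s src 0.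
Proof.
by move=> m8 src8 msrc C; have := @vec_Copy m 7 src 7 s isT isT m8 src8 msrc C; rewrite (ir7 C).
Qed.

Lemma vec_Copy_disjoint m pd src ps s l j : l != j -> ir s pd = (j * n)%N ->
  ps \notin [:: 3; 4; 20; 21]%N -> pd \notin [:: 3; 4; 20; 21]%N ->
  (m < 8)%N -> (src < 8)%N -> m != src -> consts s ->
  vec (den (Copy m pd src ps) s) m (l * n) = vec s m (l * n).
Proof.
move=> lj E *; apply/matrixP => i i'; rewrite !mxE Copy_spec // E.
rewrite ifF //; apply/negbTE; have := ltn_ord i.
by case: (ltngtP l j) lj => // lj _; nia.
Qed.

Lemma Argmax_spec p s : p \notin [:: 3; 4; 20; 21; 22]%N -> consts s ->
  ir (den (Argmax p) s) 22 = piv (vec s aH (ir s p)).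
Proof.
rewrite !inE !negb_or => /and5P[p3 p4 p20 p21 p22] C.
rewrite /Argmax !den_Seq den_FConst den_IConst; set s0 := State _ _ _.
set f := entry (vec s aH (ir s p)).
(* The running maximum starts at 0, not at the first entry; if that entry is 0 the comparison does
   not record it, but the index is already 0. *)
pose Inv t s' := ir s' 22 = argmax f t /\
  fr s' 5 = if t == 0%N then 0 else `|f (argmax f t)|.
set c := For _ _ _; suff : Inv (ir s0 0) (den c s0).
  by have -> : ir s0 0 = n := ir0 C; case.
apply: (@for_inv _ Inv 20 0 _ s0) => //.
move=> t s' lt_t x [si sf sa sm] [I1 I2].
have E : fa s' aH (ir s' p + ir s' 20) = f t.
  rewrite /f entry_vec; last by rewrite -(ir0 C).
  rewrite sa // x si; first by rewrite /s0 /= !upd_ne.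
  by rewrite !inE !negb_or p20 p4 p21 p3 p22.
have f0 : fr s' 0 = 0 by rewrite sf //; exact: fr0 C.
have i7 : ir s' 7 = 0%N by rewrite si //; exact: ir7 C.
rewrite /Inv ir_incr // fr_incr; do 3!dstep.
rewrite den_Seq; set s1 := den (IfF 1 2 _ _) _.
have [e1 e5 e0 [i22 i20 i7']] : [/\ fr s1 1 = `|f t|, fr s1 5 = fr s' 5,
    fr s1 0 = 0 & [/\ ir s1 22 = argmax f t, ir s1 20 = t & ir s1 7 = 0%N]].
  rewrite /s1 den_IfF /= -!/(fa s' aH _) E f0 sub0r.
  case: ifP => H; rewrite !stepE /upd /= ?addr0 -?/(fa s' aH _) ?E ?f0 ?sub0r ?addr0 I1 x i7; split=> //.
    by rewrite ler0_norm //; lra.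
  by rewrite ger0_norm //; move/negbT: H; rewrite -ltNge; lra.
rewrite den_IfF e1 e5 I2.
have [t0|t0] := eqVneq t 0%N.
  rewrite !t0 /= lexx; case: ifP => H; rewrite ?den_Seq !stepE /upd /= ?e5 ?e1 ?e0 ?i22 ?I2 t0 ?i20 ?i7' ?addr0 ?addn0 ?t0 //=.
  by split=> //; apply/eqP; rewrite eq_le normr_ge0 H.
by case: ifP => H; rewrite ?den_Seq !stepE /upd /= ?e5 ?e1 ?e0 ?i22 ?I2 ?i20 ?i7' ?addr0 ?addn0 ?(negbTE t0).
Qed.

Lemma Divmod_spec u g lim s : u \notin [:: 3; 4; 5; 7; 30; 31; 32; g; lim]%N ->
  g \notin [:: 30; 31; 32; 4]%N -> lim \notin [:: 30; 31; 32; 4]%N -> consts s ->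
  (ir s u <= ir s lim)%N -> (0 < ir s g)%N ->
  ir (den (Divmod u g lim) s) 32 = (ir s u %% ir s g)%N /\
  ir (den (Divmod u g lim) s) u = (ir s u %/ ir s g)%N.
Proof.
rewrite !inE !negb_or => /and5P[u3 u4 u5 u7 /and5P[u30 u31 u32 ug ulim]].
move=> /and4P[g30 g31 g32 g4] /and4P[l30 l31 l32 l4] C ule g0.
rewrite /Divmod den_Seq den_IConst; set s0 := State _ _ _; rewrite den_Seq.
set U := ir s u; set G := ir s g.
have Es0 r : r != 30%N -> ir s0 r = ir s r by move=> r30; rewrite /s0 /= upd_ne.
(* The minimum accounts for idle rounds: the quotient is at most [U], hence at most the number of
   rounds, and once it is reached nothing changes. *)
pose Inv t s' := [/\ ir s' 30 = minn t (U %/ G), (ir s' u + ir s' 30 * G)%N = U & ir s' 7 = 0%N].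
set c := For _ _ _; suff : Inv (ir s0 lim) (den c s0).
  rewrite Es0 //; case=> q e z; rewrite den_Seq !stepE /upd /= [32%N == u]eq_sym (negbTE u32) eqxx z !addn0.
  have qE : ir (den c s0) 30 = (U %/ G)%N.
    by rewrite q; apply/minn_idPr; apply: leq_trans ule; apply: leq_div.
  rewrite qE in e *; split=> //.
  by apply: (@addIn (U %/ G * G)%N); rewrite e addnC -divn_eq.
have cl : clean c.
  by rewrite /c /clean /= !inE !negb_or; lia.
apply: (@for_inv _ Inv 31 lim _ s0) => //.
  have R30 : ir (reset 31 s0) 30 = 0%N by rewrite ir_reset // /s0 /= updE.
  have Er r : r != 31%N -> r != 30%N -> ir (reset 31 s0) r = ir s r.
    by move=> r31 r30; rewrite ir_reset // Es0.
  by split; rewrite ?R30 ?Er ?(ir7 C) ?min0n ?mul0n ?addn0.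
move=> t s' lt_t x [si sf sa sm] [q e z].
have gE : ir s' g = G.
  rewrite si; first by rewrite Es0.
  by rewrite /= !inE !negb_or g31 g4 g32 g30 eq_sym ug.
rewrite /Inv !ir_incr ?inE ?negb_or ?u31 ?u4 // den_IfI gE.
case: ifP => H.
  do 2!dstep; rewrite [30 == u]eq_sym [7 == u]eq_sym.
  rewrite (negbTE u30) (negbTE u32) (negbTE u7) eqxx gE z.
  by rewrite addn1; have [] := divmod_step g0 e q H.
rewrite /Skip den_IConst /upd /= (negbTE u4); split=> //.
by apply: (divmod_stop e q); rewrite ltnNge H.
Qed.

Lemma Digit_spec s : consts s -> (ir s 32 < 2 * gridL)%N ->
  fr (den Digit s) 11 = (ir s 32)%:R - gridL%:R.
Proof.
move=> C rlt; rewrite /Digit den_Seq den_FSub; set s0 := State _ _ _.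
pose Inv t s' := fr s' 11 = (minn t (ir s 32))%:R - gridL%:R.
set c := For _ _ _; suff : Inv (ir s0 6) (den c s0).
  have -> : ir s0 6 = (2 * gridL)%N := ir6 C.
  by rewrite /Inv (minn_idPr (ltnW rlt)).
apply: (@for_inv _ Inv 31 6 _ s0) => //.
  by rewrite /Inv fr_reset /= updE (fr0 C) (fr6 C) min0n.
move=> t s' lt_t x [si sf sa sm]; rewrite /Inv => I.
have e32 : ir s' 32 = ir s 32 by rewrite si.
have e14 : fr s' 14 = 1 by rewrite sf //; exact: fr14 C.
rewrite fr_incr den_IfI x e32; case: ifP => H.
  by rewrite /Skip den_IConst /= I; congr (_%:R - _); lia.
rewrite den_FAdd /= updE I e14 addrAC natr1; congr (_%:R - _); lia.
Qed.

Lemma fr_PivotCoef s : fr (den PivotCoef s) 4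
  = fa s aB (ir s 22) / fa s aH (ir s 24 + ir s 22).
Proof. by rewrite /PivotCoef; do 4!dstep; rewrite fr_St. Qed.

Lemma fa_PivotCoef s i : fa (den PivotCoef s) aE i =
  if i == ir s 23 then fa s aB (ir s 22) / fa s aH (ir s 24 + ir s 22)
  else fa s aE i.
Proof. by rewrite /PivotCoef; do 4!dstep; rewrite fa_St. Qed.

Lemma Eliminate_spec s : consts s ->
  let h l := vec s aH (l * n) in let b := vec s aB 0 in
  vec (den Eliminate s) aB 0 = eliminate h k b /\
  forall l, (l < k)%N -> fa (den Eliminate s) aE l = elim_coef h b l.
Proof.
move=> C h b; rewrite /Eliminate den_Seq; set s0 := den _ s.
have C0 : consts s0 by apply: consts_den.
pose Inv t s' := [/\ vec s' aB 0 = eliminate h t b, ir s' 24 = (t * n)%N &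
  forall l, (l < t)%N -> fa s' aE l = elim_coef h b l].
set c := For _ _ _; suff : Inv (ir s0 2) (den c s0) by rewrite (ir2 C0) => -[-> _ H].
apply: (@for_inv _ Inv 23 2 _ s0) => //.
  split=> //; first by apply: eq_vec => i _; rewrite fa_reset // /s0 fa_den.
  by rewrite ir_reset // /s0 den_IConst /= updE.
move=> t s' lt_t x S [I1 I2 I3].
have C' : consts s' by apply: consts_same S C0.
have hE : vec s' aH (t * n) = h t.
  have [_ _ sa _] := S; apply: eq_vec => i _.
  by rewrite sa // /s0 fa_den.
rewrite 3!den_Seq; set s1 := den (Argmax 24) s'.
set s2 := den PivotCoef s1; set s3 := den (Axpy _ _ _) s2.
have C1 : consts s1 by apply: consts_den.
have C2 : consts s2 by apply: consts_den.
have p22 : ir s1 22 = piv (h t) by rewrite /s1 Argmax_spec // I2 hE.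
have pn : (piv (h t) < n)%N by apply: argmax_lt.
have i24 : ir s1 24 = (t * n)%N by rewrite /s1 ir_den.
have i23 : ir s1 23 = t by rewrite /s1 ir_den.
have cE : fa s1 aB (ir s1 22) / fa s1 aH (ir s1 24 + ir s1 22) = elim_coef h b t.
  rewrite /s1 !fa_den // -/s1 p22 i24.
  have -> : fa s' aB (piv (h t)) = entry (vec s' aB 0) (piv (h t)) by rewrite entry_vec.
  by rewrite -entry_vec // I1 hE.
rewrite /Inv !den_IAdd; split.
- rewrite (_ : vec _ _ _ = vec s3 aB 0); last first.
    by apply: eq_vec => i _; rewrite fa_incr // fa_state // upd_ne.
  rewrite /s3 Axpy_spec // /s2 fr_PivotCoef cE ir_den // i24 !vec_den //.
  by rewrite hE I1.
- rewrite ir_incr // /= updE /s3 ir_den // /s2 ir_den // i24 ir_den // ir_den //.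
  by rewrite (ir0 C1) mulSn addnC.
- move=> l; rewrite ltnS => lt; rewrite fa_incr // fa_state ?upd_ne //.
  rewrite /s3 fa_den // /s2 fa_PivotCoef i23 cE; case: eqP => [->//|ne].
  by rewrite /s1 fa_den // I3 // ltn_neqAle lt andbT; apply/eqP.
Qed.

(** * Correctness of the grid search *)

Lemma gridL_gt0 : (0 < gridL)%N.
Proof. by rewrite expn_gt0. Qed.

Lemma GridPoint_spec s : consts s ->
  let q l := vec s aQ (l * n) in let b := vec s aB 0 in
  fr s 9 = cnorm b / (4 * k%:R) -> (ir s 26 < (2 * gridL) ^ k)%N ->
  vec (den GridPoint s) aC 0
    = grid_point k q b gridL (fun l => (ir s 26 %/ (2 * gridL) ^ l) %% (2 * gridL))%N.
Proof.
move=> C q b f9 zlt; set z := ir s 26 in zlt *; set G := (2 * gridL)%N in zlt *.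
pose a l := fr s 9 / cnorm (q l) * (((z %/ G ^ l) %% G)%N%:R - gridL%:R).
rewrite /GridPoint 3!den_Seq; set s0 := den (Reg (IConst 29 0)) _.
have C0 : consts s0 by do 3![apply: consts_den => //].
pose Inv t s' := [/\ vec s' aC 0 = b - \sum_(0 <= l < t) a l *: q l,
  ir s' 27 = (z %/ G ^ t)%N & ir s' 29 = (t * n)%N].
set c := For _ _ _; suff : Inv (ir s0 2) (den c s0).
  by rewrite (ir2 C0) => -[-> _ _]; rewrite /grid_point big_mkord /a f9.
apply: (@for_inv _ Inv 28 2 _ s0) => //.
  split.
  - rewrite big_geq // subr0 /b -[RHS](@vec_Copy0 aC) //.
    by apply: eq_vec => i _; rewrite fa_reset // /s0 fa_den // fa_den.
  - rewrite ir_reset // /s0 ir_den // den_IAdd /= updE !ir_den // (ir7 C).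
    by rewrite addn0 expn0 divn1.
  - by rewrite ir_reset // /s0 den_IConst /= updE.
move=> t s' lt_t x S [I1 I2 I3].
have C' : consts s' by apply: consts_same S C0.
have [si sf sa sm] := S.
have qE : vec s' aQ (t * n) = q t.
  by apply: eq_vec => i _; rewrite sa // /s0 !fa_den.
have f9' : fr s' 9 = fr s 9 by rewrite sf // /s0 !fr_den.
rewrite 6!den_Seq; set s1 := den (Divmod _ _ _) s'.
set s2 := den (Norm _ _) s1; set s3 := den (Reg (FDiv _ _ _)) s2.
set s4 := den Digit s3; set s5 := den (Reg (FMul _ _ _)) s4.
set s6 := den (Axpy _ _ _) s5.
have C1 : consts s1 by apply: consts_den.
have C2 : consts s2 by apply: consts_den.
have C3 : consts s3 by apply: consts_den.
have C4 : consts s4 by apply: consts_den.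
have C5 : consts s5 by apply: consts_den.
have C6 : consts s6 by apply: consts_den.
have G0 : (0 < G)%N by rewrite muln_gt0 gridL_gt0.
have [r32 u27] : ir s1 32 = (z %/ G ^ t %% G)%N /\ ir s1 27 = (z %/ G ^ t.+1)%N.
  have [||H1 H2] := @Divmod_spec 27 6 8 s' isT isT isT C'.
  - by rewrite I2 (ir8 C') -/G; apply: leq_trans (leq_div _ _) (ltnW zlt).
  - by rewrite (ir6 C').
  by rewrite /s1 H1 H2 I2 (ir6 C') -/G -divnMA expnSr.
have i29 : ir s1 29 = (t * n)%N by rewrite /s1 ir_den.
have n3 : fr s2 3 = cnorm (q t).
  by rewrite /s2 Norm_spec // i29 /s1 vec_den // qE.
have f4 : fr s3 4 = fr s 9 / cnorm (q t).
  by rewrite /s3 den_FDiv /= updE n3 /s2 fr_den // /s1 fr_den // f9'.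
have f11 : fr s4 11 = ((z %/ G ^ t) %% G)%N%:R - gridL%:R.
  have e32 : ir s3 32 = (z %/ G ^ t %% G)%N by rewrite /s3 ir_den // /s2 ir_den.
  by rewrite /s4 Digit_spec // e32 // ltn_mod.
have f4' : fr s5 4 = a t.
  by rewrite /s5 den_FMul /= updE f11 /s4 fr_den // f4.
have i29' : ir s5 29 = (t * n)%N.
  by rewrite /s5 ir_den // /s4 ir_den // /s3 ir_den // /s2 ir_den.
have vQ : vec s5 aQ (t * n) = q t.
  by rewrite /s5 vec_den // /s4 vec_den // /s3 vec_den // /s2 vec_den // /s1 vec_den.
have vC : vec s5 aC 0 = vec s' aC 0.
  by rewrite /s5 vec_den // /s4 vec_den // /s3 vec_den // /s2 vec_den // /s1 vec_den.
rewrite /Inv !den_IAdd; split.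
- rewrite (_ : vec _ _ _ = vec s6 aC 0); last first.
    by apply: eq_vec => i _; rewrite fa_incr // fa_state // upd_ne.
  rewrite /s6 Axpy_spec // f4' i29' vQ vC I1 big_nat_recr //=.
  by rewrite opprD addrA.
- rewrite ir_incr // /= upd_ne // /s6 ir_den // /s5 ir_den // /s4 ir_den //.
  by rewrite /s3 ir_den // /s2 ir_den.
- rewrite ir_incr // /= updE (ir0 C6) /s6 ir_den // i29'.
  by rewrite mulSn addnC.
Qed.

Lemma GridStep_spec s : consts s ->
  grid_step k (fun l => vec s aQ (l * n)) gridL (vec s aB 0) (vec (den GridStep s) aB 0).
Proof.
move=> C; set q := fun l => _; set b := vec s aB 0.
rewrite /GridStep 5!den_Seq; set s1 := den (Norm _ _) s.
set s2 := den (Reg _) s1; set s3 := den (Copy _ _ _ _) s2.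
set s4 := den (Reg (FAdd _ _ _)) s3.
have C1 : consts s1 by apply: consts_den.
have C2 : consts s2 by apply: consts_den.
have C3 : consts s3 by apply: consts_den.
have C4 : consts s4 by apply: consts_den.
have n3 : fr s1 3 = cnorm b by rewrite /s1 Norm_spec // (ir7 C).
have f9 : fr s4 9 = cnorm b / (4 * k%:R).
  by rewrite /s4 fr_den // /s3 fr_den // /s2 den_FDiv /= updE n3 (fr7 C1).
have f10 : fr s4 10 = cnorm b.
  by rewrite /s4 den_FAdd /= updE (fr0 C3) addr0 /s3 fr_den // /s2 fr_den.
have vX : vec s4 aX 0 = b.
  rewrite /s4 vec_den // /s3 vec_Copy0 //.
  by rewrite /s2 vec_den // /s1 vec_den.
have vB : vec s4 aB 0 = b.
  by rewrite /s4 vec_den // /s3 vec_den // /s2 vec_den // /s1 vec_den.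
have vQ l : vec s4 aQ (l * n) = q l.
  by rewrite /s4 vec_den // /s3 vec_den // /s2 vec_den // /s1 vec_den.
pose G := (2 * gridL)%N; pose dig z l := ((z %/ G ^ l) %% G)%N.
pose Inv t s' := [/\ fr s' 10 = cnorm (vec s' aX 0), spanned k q (b - vec s' aX 0),
  cnorm (vec s' aX 0) <= cnorm b &
  forall z, (z < t)%N -> cnorm (vec s' aX 0) <= cnorm (grid_point k q b gridL (dig z))].
set c := For _ _ _.
have : Inv (ir s4 8) (den c s4).
  apply: (@for_inv _ Inv 26 8 _ s4) => //.
    have E : vec (reset 26 s4) aX 0 = b.
      by rewrite -vX; apply: eq_vec => i _; rewrite fa_reset.
    by split; rewrite ?E ?fr_reset ?f10 // subrr; apply: spanned0.
  move=> t s' lt_t x S [I1 I2 I3 I4].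
  have C' : consts s' by apply: consts_same S C4.
  have [si sf sa sm] := S.
  have vB' : vec s' aB 0 = b by rewrite -vB; apply: eq_vec => i _; rewrite sa.
  have vQ' l : vec s' aQ (l * n) = q l by rewrite -vQ; apply: eq_vec => i _; rewrite sa.
  rewrite 2!den_Seq; set s5 := den GridPoint s'; set s6 := den (Norm _ _) s5.
  have C5 : consts s5 by apply: consts_den.
  have C6 : consts s6 by apply: consts_den.
  have gp : vec s5 aC 0 = grid_point k q b gridL (dig t).
    rewrite /s5 GridPoint_spec // ?vB' ?sf // ?x //; last by rewrite -(ir8 C4).
    rewrite /grid_point; congr (_ - _); apply: eq_bigr => l _; by rewrite vQ'.
  have n3' : fr s6 3 = cnorm (grid_point k q b gridL (dig t)).
    by rewrite /s6 Norm_spec // (ir7 C5) gp.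
  have f10' : fr s6 10 = cnorm (vec s' aX 0) by rewrite /s6 fr_den // /s5 fr_den.
  have vX' : vec s6 aX 0 = vec s' aX 0 by rewrite /s6 vec_den // /s5 vec_den.
  rewrite den_IfF n3' f10'; case: leP => H.
    rewrite den_Seq; set s7 := den (Reg _) s6; set s8 := den (Copy _ _ _ _) s7.
    have C7 : consts s7 by apply: consts_den.
    have E : vec (incr 26 s8) aX 0 = grid_point k q b gridL (dig t).
      rewrite -gp (_ : vec _ _ _ = vec s8 aX 0); last first.
        by apply: eq_vec => i _; rewrite fa_incr.
      rewrite /s8 vec_Copy0 //.
      by rewrite /s7 vec_den // /s6 vec_den.
    split; rewrite E.
    - rewrite fr_incr /s8 fr_den // /s7 den_FAdd /= updE n3' (fr0 C6) addr0 //.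
    - rewrite /grid_point opprB addrC subrK.
      by exists (fun l => cnorm b / (4 * k%:R) / cnorm (q l) * ((dig t l)%:R - gridL%:R)).
    - exact: le_trans H I3.
    - move=> z; rewrite ltnS leq_eqVlt => /orP[/eqP->//|zt].
      exact: le_trans H (I4 z zt).
  have E : vec (incr 26 (den Skip s6)) aX 0 = vec s' aX 0.
    by rewrite -vX'; apply: eq_vec => i _; rewrite fa_incr // fa_den.
  split; rewrite E //.
    by rewrite fr_incr fr_den.
  by move=> z; rewrite ltnS leq_eqVlt => /orP[/eqP->|zt]; [apply: ltW|apply: I4].
set s5 := den c s4; have C5 : consts s5 by apply: consts_den.
case=> _ I2 I3 I4; rewrite (ir8 C4) in I4.
have -> : vec (den (Copy aB 7 aX 7) s5) aB 0 = vec s5 aX 0.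
  by rewrite vec_Copy0 //.
split=> // z zG; have [t tlt tz] := exists_digits zG.
have -> : grid_point k q b gridL z = grid_point k q b gridL (dig t).
  by rewrite /grid_point; congr (_ - _); apply: eq_bigr => l _; rewrite /dig tz.
exact: I4.
Qed.

Lemma Refine_spec s : consts s -> exists bs : nat -> 'cV[R]_n,
  [/\ bs 0%N = vec s aB 0, bs (n * k)%N = vec (den Refine s) aB 0 &
   forall i, (i < n * k)%N ->
     grid_step k (fun l => vec s aQ (l * n)) gridL (bs i) (bs i.+1)].
Proof.
move=> C; pose q l := vec s aQ (l * n).
pose Inv t s' := exists bs : nat -> 'cV[R]_n, [/\ bs 0%N = vec s aB 0,
  bs t = vec s' aB 0 & forall i, (i < t)%N -> grid_step k q gridL (bs i) (bs i.+1)].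
rewrite -(ir10 C); apply: (@for_inv _ Inv 25 10 _ s) => //.
  by exists (fun=> vec s aB 0).
move=> t s' lt_t x S [bs [b0 bt bi]].
have C' : consts s' by apply: consts_same S C.
have [si sf sa sm] := S.
(* The sequence of residuals is existential, so the invariant extends it by the value just
   computed. *)
exists (fun i => if (i <= t)%N then bs i else vec (den GridStep s') aB 0); split=> //.
  by rewrite ltnn; apply: esym; apply: eq_vec => i _; rewrite fa_incr.
move=> i; rewrite ltnS => it; rewrite it; case: ltnP => [lt|ge]; first exact: bi.
have -> : i = t by apply/eqP; rewrite eqn_leq it.
have := GridStep_spec C'; rewrite bt.
suff -> : (fun l => vec s' aQ (l * n)) = q by [].
by apply/funext => l; apply: eq_vec => j _; rewrite sa.
Qed.

(** * Columns, bases and coefficients *)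

Lemma LoadCol_spec c s (j : 'I_d) : consts s -> ir s c = j ->
  vec (den (LoadCol c) s) aB 0 = col j A.
Proof.
move=> C cj; rewrite /LoadCol den_Seq; set s0 := den _ s.
have C0 : consts s0 by apply: consts_den.
pose Inv t s' := ir s' 38 = (t * d + j)%N /\
  forall i, (i < t)%N -> fa s' aB i = fm s0 (i * d + j)%N.
set f := For _ _ _; suff : Inv (ir s0 0) (den f s0).
  rewrite (ir0 C0) => -[_ H]; apply/matrixP => i j'; rewrite !mxE add0n H //.
  exact: rawA C0 i j.
apply: (@for_inv _ Inv 20 0 _ s0) => //.
  by split=> //; rewrite ir_reset // /s0 den_IAdd /= updE cj (ir7 C) addn0.
move=> t s' lt_t x [si sf sa sm] [I1 I2]; split.
  rewrite ir_incr //; do !dstep.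
  rewrite !ir_den //= I1 si // (ir1 C0) mulSn; lia.
move=> i; rewrite ltnS => it; rewrite fa_incr // 2!den_Seq den_IAdd fa_state; last by rewrite upd_ne.
rewrite fa_St // den_FLoad eqxx /= x updE -!/(fa s' _ _); case: eqP => [->|ne].
  rewrite I1 sm // (ir5 C0); rewrite (ir0 C0) in lt_t.
  exact: (raw_lt (Ordinal lt_t) j).
by rewrite I2 // ltn_neqAle it andbT; apply/eqP.
Qed.

Lemma Residue_spec s (j : 'I_d) : consts s -> ir s 35 = j ->
  vec (den Residue s) aB 0 = col j A - vec s aB 0.
Proof.
move=> C cj; rewrite /Residue den_Seq; set s0 := den _ s.
have C0 : consts s0 by apply: consts_den.
pose Inv t s' := ir s' 38 = (t * d + j)%N /\
  forall i, fa s' aB i = if (i < t)%N then fm s0 (i * d + j)%N - fa s0 aB i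
                         else fa s0 aB i.
set f := For _ _ _; suff : Inv (ir s0 0) (den f s0).
  rewrite (ir0 C0) => -[_ H]; apply/matrixP => i j'; rewrite !mxE H add0n ltn_ord.
  by rewrite (rawA C0 i j) /s0 fa_den.
apply: (@for_inv _ Inv 20 0 _ s0) => //.
  by split=> //; rewrite ir_reset // /s0 den_IAdd /= updE cj (ir7 C) addn0.
move=> t s' lt_t x [si sf sa sm] [I1 I2]; split.
  rewrite ir_incr //; do !dstep.
  rewrite !ir_den //= I1 si // (ir1 C0) mulSn; lia.
move=> i; rewrite fa_incr // 4!den_Seq den_IAdd fa_state; last by rewrite upd_ne.
rewrite fa_St // den_FSub den_Ld den_FLoad /upd /= x -!/(fa s' aB _) !I2 ltnS.
case: (ltngtP i t) => // ->.
rewrite ltnn I1 sm // (ir5 C0).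
rewrite (ir0 C0) in lt_t.
exact: (raw_lt (Ordinal lt_t) j).
Qed.

Lemma StoreCoefs_spec s (j : 'I_d) l (j' : 'I_d) : consts s -> ir s 35 = j -> (l < k)%N ->
  fa (den StoreCoefs s) aV (l * d + j') = if j' == j then fa s aE l else fa s aV (l * d + j').
Proof.
move=> C cj lk; rewrite /StoreCoefs den_Seq; set s0 := den _ s.
have C0 : consts s0 by apply: consts_den.
pose Inv t s' := ir s' 38 = (t * d + j)%N /\
  forall l (j' : 'I_d), fa s' aV (l * d + j') =
    if (j' == j) && (l < t)%N then fa s aE l else fa s aV (l * d + j').
set f := For _ _ _; suff : Inv (ir s0 2) (den f s0).
  by rewrite (ir2 C0) => -[_ ->]; rewrite lk andbT.
apply: (@for_inv _ Inv 20 2 _ s0) => //.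
  split=> [|l' i]; last by rewrite andbF fa_reset // /s0 fa_den.
  by rewrite ir_reset // /s0 den_IAdd /= updE cj (ir7 C) addn0.
move=> t s' lt_t x [si sf sa sm] [I1 I2]; split.
  rewrite ir_incr //; do !dstep.
  rewrite !ir_den //= I1 si // (ir1 C0) mulSn; lia.
move=> l' i; rewrite fa_incr // 2!den_Seq den_IAdd fa_state; last by rewrite upd_ne.
rewrite fa_St // den_Ld /upd /= x -!/(fa s' _ _) I1 row_major_eq // I2 ltnS.
rewrite sa // /s0 fa_den // -val_eqE /=.
by case: (ltngtP l' t) => [||->] //=; case: eqP.
Qed.

Lemma Clear_spec s : consts s -> forall l, (l < k)%N ->
  vec (den Clear s) aH (l * n) = 0 /\ vec (den Clear s) aQ (l * n) = 0.
Proof.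
move=> C.
pose Inv t s' := forall i, (i < t)%N -> fa s' aH i = 0 /\ fa s' aQ i = 0.
suff H : Inv (n * k)%N (den Clear s).
  have lt l (i : 'I_n) : (l < k)%N -> (l * n + i < n * k)%N.
    by move=> lk; have := ltn_ord i; nia.
  move=> l lk; split; apply/matrixP => i j; rewrite !mxE.
    exact: (H _ (lt l i lk)).1.
  exact: (H _ (lt l i lk)).2.
rewrite -(ir10 C); apply: (@for_inv _ Inv 20 10 _ s) => //.
move=> t s' lt_t x [si sf sa sm] I i; rewrite ltnS => it.
have f0 : fr s' 0 = 0 by rewrite sf // (fr0 C).
rewrite !fa_incr // den_Seq !fa_St // !ir_den // !fr_den // x f0 /=.
case: eqP => // ne; apply: I; rewrite ltn_neqAle it andbT; exact/eqP.
Qed.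

Lemma gridL_large : 8 * k%:R * 5 ^+ k < gridL%:R :> R.
Proof.
rewrite -natrX -!natrM ltr_nat /gridL expnS.
have H1 : (k < 2 ^ k)%N by apply: ltn_expl.
have H2 : (2 ^ k * 5 ^ k <= 16 ^ k)%N by rewrite -expnMn leq_exp2r.
have H3 : (0 < 5 ^ k)%N by rewrite expn_gt0.
nia.
Qed.

(** The counter [t] of the search encodes [k] columns as its digits in base [d]. *)
Definition dcol (t l : nat) : 'I_d := Ordinal (ltn_pmod (t %/ d ^ l) d_gt0).

Lemma Refine_near_opt a h q j s b : consts s -> (forall l, vec s aQ (l * n) = q l) ->
  basis_inv k a h q j -> vec s aB 0 = eliminate h k b ->
  near_opt k h b (vec (den Refine s) aB 0).
Proof.
move=> C /funext qE BI vB; have [bs [b0 <- bi]] := Refine_spec C; rewrite qE in bi.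
apply: near_opt_refine bi => //.
- exact: inv_triangular BI.
- exact: inv_conditioned BI.
- exact: gridL_large.
- by move=> v; apply: basis_inv_span BI.
- by rewrite b0.
Qed.

(** The chosen columns may repeat or be dependent: a column already in the span has residual 0, and
    zero vectors are harmless in both bases. *)
Lemma Basis_spec s : consts s -> (ir s 33 < d ^ k)%N ->
  basis_inv k (fun l => col (dcol (ir s 33) l) A) (fun l => vec (den Basis s) aH (l * n))
    (fun l => vec (den Basis s) aQ (l * n)) k.
Proof.
move=> C tlt; set T := ir s 33 in tlt *; pose a l := col (dcol T l) A.
rewrite /Basis 3!den_Seq; set sc := den Clear s; set s0 := den (Reg (IConst 36 0)) _.
have Cc : consts sc by apply: consts_den.
have C0 : consts s0 by do 2![apply: consts_den => //].
pose Inv j s' := [/\ ir s' 34 = (T %/ d ^ j)%N, ir s' 36 = (j * n)%N &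
  basis_inv k a (fun l => vec s' aH (l * n)) (fun l => vec s' aQ (l * n)) j].
set f := For _ _ _; suff : Inv (ir s0 2) (den f s0) by rewrite (ir2 C0) => -[].
apply: (@for_inv _ Inv 35 2 _ s0) => //.
  split.
  - rewrite ir_reset // /s0 ir_den // den_IAdd /= updE (ir7 Cc) /sc ir_den //.
    by rewrite addn0 expn0 divn1.
  - by rewrite ir_reset // /s0 den_IConst /= updE.
  - apply: basis_inv0 => l lk.
      rewrite -(Clear_spec C lk).1; apply: eq_vec => i _.
      by rewrite fa_reset // /s0 fa_den // fa_den.
    rewrite -(Clear_spec C lk).2; apply: eq_vec => i _.
    by rewrite fa_reset // /s0 fa_den // fa_den.
move=> j s' jk x S [I1 I2 BI]; rewrite (ir2 C0) in jk.
have C' : consts s' by apply: consts_same S C0.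
set h := (X in basis_inv k a X) in BI; set q := (X in basis_inv k a h X) in BI.
rewrite 6!den_Seq; set s1 := den (Divmod _ _ _) s'; set s2 := den (LoadCol _) s1.
set s3 := den Eliminate s2; set s4 := den (Copy aH 36 aB 7) s3.
set s5 := den Refine s4; set s6 := den (Copy aQ 36 aB 7) s5.
have C1 : consts s1 by apply: consts_den.
have C2 : consts s2 by apply: consts_den.
have C3 : consts s3 by apply: consts_den.
have C4 : consts s4 by apply: consts_den.
have C5 : consts s5 by apply: consts_den.
have C6 : consts s6 by apply: consts_den.
have [r32 u34] : ir s1 32 = dcol T j /\ ir s1 34 = (T %/ d ^ j.+1)%N.
  have [||H1 H2] := @Divmod_spec 34 1 9 s' isT isT isT C'.
  - by rewrite I1 (ir9 C'); apply: leq_trans (leq_div _ _) (ltnW tlt).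
  - by rewrite (ir1 C').
  by rewrite /s1 H1 H2 I1 (ir1 C') -divnMA expnSr.
have vB2 : vec s2 aB 0 = a j by apply: LoadCol_spec.
have vH2 l : vec s2 aH (l * n) = h l by rewrite /s2 vec_den // /s1 vec_den.
have vB3 : vec s3 aB 0 = eliminate h k (a j).
  rewrite /s3 (Eliminate_spec C2).1 vB2; apply: eq_eliminate => m _; exact: vH2.
have i36 : ir s3 36 = (j * n)%N by rewrite /s3 ir_den // /s2 ir_den // /s1 ir_den.
have vH3 l : vec s3 aH (l * n) = h l by rewrite /s3 vec_den.
have vH4j : vec s4 aH (j * n) = eliminate h k (a j).
  by rewrite /s4 -i36 vec_Copy // (ir7 C3) vB3.
have vH4 l : l != j -> vec s4 aH (l * n) = h l.
  by move=> lj; rewrite /s4 (vec_Copy_disjoint lj i36) // vH3.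
have vQ4 l : vec s4 aQ (l * n) = q l.
  by rewrite /s4 vec_den // /s3 vec_den // /s2 vec_den // /s1 vec_den.
have vB4 : vec s4 aB 0 = eliminate h k (a j) by rewrite /s4 vec_den.
have nb : near_opt k h (a j) (vec s5 aB 0).
  exact: Refine_near_opt BI vB4.
have i36' : ir s5 36 = (j * n)%N by rewrite /s5 ir_den // /s4 ir_den.
have fin m p : (m < 8)%N -> vec (incr 35 (den (Reg (IAdd 36 36 0)) s6)) m p = vec s6 m p.
  by move=> m8; apply: eq_vec => i _; rewrite fa_incr // fa_den.
split.
- rewrite ir_incr // ir_den // /s6 ir_den // /s5 ir_den // /s4 ir_den //.
  by rewrite /s3 ir_den // /s2 ir_den.
- rewrite ir_incr // den_IAdd /= updE /s6 ir_den // i36' (ir0 C6).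
  by rewrite mulSn addnC.
- apply: (basis_inv_step jk BI nb).
  + by rewrite fin // /s6 vec_den // /s5 vec_den.
  + by move=> l lk lj; rewrite fin // /s6 vec_den // /s5 vec_den // vH4.
  + by rewrite fin // /s6 -i36' vec_Copy // (ir7 C5).
  + move=> l lk lj; rewrite fin // /s6 (vec_Copy_disjoint lj i36') //.
    by rewrite /s5 vec_den // vQ4.
Qed.

Lemma Solve_spec a s : consts s ->
  let h l := vec s aH (l * n) in
  basis_inv k a h (fun l => vec s aQ (l * n)) k ->
  exists e : 'I_d -> R, [/\ fr (den Solve s) 12 = \sum_j e j,
    forall j, e j = cnorm (col j A - \sum_(l < k) fa (den Solve s) aV (l * d + j) *: h l) &
    forall j v, spanned k h v -> e j <= 4 * cnorm (col j A - v)].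
Proof.
move=> C h BI; set q := (X in basis_inv k a h X) in BI.
rewrite /Solve den_Seq; set s0 := den _ s.
have C0 : consts s0 by apply: consts_den.
pose Inv t s' := exists e : nat -> R, [/\ fr s' 12 = \sum_(0 <= j < t) e j,
  forall j : 'I_d, (j < t)%N ->
    e j = cnorm (col j A - \sum_(l < k) fa s' aV (l * d + j) *: h l) &
  forall (j : 'I_d) v, (j < t)%N -> spanned k h v -> e j <= 4 * cnorm (col j A - v)].
set f := For _ _ _; suff : Inv (ir s0 1) (den f s0).
  rewrite (ir1 C0) => -[e [e1 e2 e3]]; exists e; split=> [|j|j v].
  - by rewrite e1 big_mkord.
  - exact: e2.
  - exact: e3.
apply: (@for_inv _ Inv 35 1 _ s0) => //.
  exists (fun=> 0); split=> //.
  by rewrite fr_reset /s0 den_FConst /= updE big_geq.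
move=> t s' lt_t x S [e [e1 e2 e3]]; rewrite (ir1 C0) in lt_t.
have C' : consts s' by apply: consts_same S C0.
have [si sf sa sm] := S.
have vH l : vec s' aH (l * n) = h l.
  by apply: eq_vec => i _; rewrite sa // /s0 fa_den.
have vQ l : vec s' aQ (l * n) = q l.
  by apply: eq_vec => i _; rewrite sa // /s0 fa_den.
pose j := Ordinal lt_t.
rewrite 7!den_Seq; set s1 := den (LoadCol _) s'; set s2 := den Eliminate s1.
set s3 := den Refine s2; set s4 := den (Norm _ _) s3; set s5 := den (Reg _) s4.
set s6 := den Residue s5; set s7 := den Eliminate s6; set s8 := den StoreCoefs s7.
have C1 : consts s1 by apply: consts_den.
have C2 : consts s2 by apply: consts_den.
have C3 : consts s3 by apply: consts_den.
have C4 : consts s4 by apply: consts_den.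
have C5 : consts s5 by apply: consts_den.
have C6 : consts s6 by apply: consts_den.
have C7 : consts s7 by apply: consts_den.
have vB1 : vec s1 aB 0 = col j A by apply: LoadCol_spec.
have vH1 l : vec s1 aH (l * n) = h l by rewrite /s1 vec_den.
have vB2 : vec s2 aB 0 = eliminate h k (col j A).
  by rewrite /s2 (Eliminate_spec C1).1 vB1; apply: eq_eliminate => m _; apply: vH1.
have vQ2 l : vec s2 aQ (l * n) = q l by rewrite /s2 vec_den // /s1 vec_den.
set b := vec s3 aB 0.
have [sb nb] : near_opt k h (col j A) b.
  exact: Refine_near_opt BI vB2.
have f3 : fr s4 3 = cnorm b by rewrite /s4 Norm_spec // (ir7 C3).
have f12 : fr s5 12 = fr s' 12 + cnorm b.
  rewrite /s5 den_FAdd /= updE f3 /s4 fr_den // /s3 fr_den // /s2 fr_den //.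
  by rewrite /s1 fr_den.
have i35 : ir s5 35 = j.
  rewrite /s5 ir_den // /s4 ir_den // /s3 ir_den // /s2 ir_den // /s1 ir_den //.
have vB6 : vec s6 aB 0 = col j A - b.
  rewrite /s6 (Residue_spec C5 i35) /s5 vec_den // /s4 vec_den //.
have vH6 l : vec s6 aH (l * n) = h l.
  by rewrite /s6 vec_den // /s5 vec_den // /s4 vec_den // /s3 vec_den // /s2 vec_den.
have hE : (fun l => vec s6 aH (l * n)) = h by apply/funext => l; rewrite vH6.
have [z7 c7] := Eliminate_spec C6; rewrite hE vB6 in z7 c7.
(* [col j A - b] lies in the span, so elimination takes it to 0; the elimination coefficients are
   then its exact coordinates. *)
have bE : b = col j A - \sum_(l < k) fa s7 aE l *: h l.
  have := eliminate_spanned (inv_triangular BI) sb; rewrite eliminateE => /eqP.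
  rewrite subr_eq0 => /eqP E.
  rewrite (eq_bigr (fun l : 'I_k => elim_coef h (col j A - b) l *: h l)).
    by rewrite -E opprB addrC subrK.
  by move=> l _; rewrite /s7 c7.
have i35' : ir s7 35 = j by rewrite /s7 ir_den // /s6 ir_den.
exists (fun i => if i == t then cnorm b else e i); split.
- rewrite fr_incr /s8 fr_den // /s7 fr_den // /s6 fr_den // f12 e1 big_nat_recr //= eqxx.
  congr (_ + _); apply: eq_big_nat => i /andP[_ it].
  by rewrite (ltn_eqF it).
- move=> i; rewrite ltnS => it; case: eqP => [E|ne].
    have -> : i = j by apply: val_inj.
    rewrite {1}bE; congr (cnorm (_ - _)); apply: eq_bigr => l _.
    by rewrite fa_incr // /s8 (StoreCoefs_spec _ C7 i35') // eqxx.
  have lt : (i < t)%N by rewrite ltn_neqAle it andbT; apply/eqP.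
  rewrite e2 //; congr (cnorm (_ - _)); apply: eq_bigr => l _.
  rewrite fa_incr // /s8 (StoreCoefs_spec _ C7 i35') //.
  rewrite -val_eqE /= (ltn_eqF lt) /s7 fa_den // /s6 fa_den // /s5 fa_den //.
  by rewrite /s4 fa_den // /s3 fa_den // /s2 fa_den // /s1 fa_den.
- move=> i v; rewrite ltnS => it sv; case: eqP => [E|ne].
    have -> : i = j by apply: val_inj.
    exact: nb.
  by apply: e3 => //; rewrite ltn_neqAle it andbT; apply/eqP.
Qed.

(** The index is transposed: [aH] is stored column by column, the output row by row. *)
Lemma RecordU_spec s x : consts s -> (x < n * k)%N ->
  fa (den RecordU s) aO x = fa s aH (x %% k * n + x %/ k)%N.
Proof.
move=> C; rewrite /RecordU den_Seq; set s0 := den _ s.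
have C0 : consts s0 by apply: consts_den.
pose F x := fa s aH (x %% k * n + x %/ k)%N.
pose Inv t s' := ir s' 36 = (t * k)%N /\ forall x, (x < t * k)%N -> fa s' aO x = F x.
set f := For _ _ _; suff : Inv (ir s0 0) (den f s0).
  by rewrite (ir0 C0) => -[_ H] xlt; apply: H.
apply: (@for_inv _ Inv 20 0 _ s0) => //.
  by split=> //; rewrite ir_reset // /s0 den_IConst /= updE.
move=> t s' lt_t xt S [I1 I2].
have C' : consts s' by apply: consts_same S C0.
have [si sf sa sm] := S.
rewrite den_Seq; set s1 := den _ s'.
have C1 : consts s1 by apply: consts_den.
have hE y : fa s1 aH y = fa s aH y by rewrite /s1 fa_den // sa // /s0 fa_den.
pose Jnv u s'' := [/\ ir s'' 38 = (u * n + t)%N, ir s'' 36 = (t * k + u)%N &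
  forall x, (x < t * k + u)%N -> fa s'' aO x = F x].
set g := For _ _ _; have : Jnv (ir s1 2) (den g s1).
  apply: (@for_inv _ Jnv 23 2 _ s1) => //.
    split; rewrite ?ir_reset // /s1 ?addn0.
    - by rewrite den_IAdd /= updE xt (ir7 C') addn0.
    - by rewrite ir_den.
    - by move=> y yt; rewrite fa_reset // fa_den // I2.
  move=> u s'' lt_u xu S' [J1 J2 J3].
  have C'' : consts s'' by apply: consts_same S' C1.
  have [ti tf ta tm] := S'.
  rewrite (ir2 C1) in lt_u.
  split.
  - rewrite ir_incr //; do !dstep; rewrite !ir_den //= J1 (ir0 C'') mulSn; lia.
  - by rewrite ir_incr //; do !dstep; rewrite !ir_den //= J2 addn1 addnS.
  - move=> y; rewrite addnS ltnS => yt; rewrite fa_incr // 4!den_Seq 3?[fa (den (Reg _) _) _ _]fa_den //.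
    rewrite fa_St // den_Ld /upd /= -!/(fa s'' _ _) J1 J2 ta // hE.
    case: eqP => [->|ne].
      by rewrite /F modnMDl modn_small // divnMDl // divn_small // addn0.
    by apply: J3; rewrite ltn_neqAle yt andbT; apply/eqP.
rewrite (ir2 C1) => -[_ J2 J3]; split.
  by rewrite ir_incr // J2 mulSn addnC.
by move=> y; rewrite mulSn addnC => yt; rewrite fa_incr // J3.
Qed.

Lemma RecordV_spec s : consts s ->
  (forall x, (x < k * d)%N -> fa (den RecordV s) aO (n * k + x) = fa s aV x) /\
  (forall x, (x < n * k)%N -> fa (den RecordV s) aO x = fa s aO x).
Proof.
move=> C; pose Inv t s' := forall x, fa s' aO x =
  if (n * k <= x < n * k + t)%N then fa s aV (x - n * k) else fa s aO x.
suff H : Inv (k * d)%N (den RecordV s).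
  split=> x xlt; rewrite H; first by rewrite leq_addr ltn_add2l xlt addKn.
  by rewrite leqNgt xlt.
rewrite -(ir11 C); apply: (@for_inv _ Inv 20 11 _ s) => //.
  by move=> x; rewrite fa_reset // addn0; case: ifP => // /andP[a1 /(leq_ltn_trans a1)]; rewrite ltnn.
move=> t s' lt_t xt S I x.
have C' : consts s' by apply: consts_same S C.
have [si sf sa sm] := S.
rewrite fa_incr // 2!den_Seq fa_St // den_Ld den_IAdd /upd /= -!/(fa s' _ _).
rewrite xt (ir10 C') sa // I; case: eqP => [->|ne].
  by rewrite leq_addr addnS ltnS leqnn addKn.
by rewrite addnS ltnS [(x <= _)%N]leq_eqVlt; case: eqP ne.
Qed.

Lemma Keep_accept s : consts s -> fr s 12 <= fr s 13 \/ ir s 33 = 0%N ->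
  [/\ fr (den Keep s) 13 = fr s 12,
    forall x, (x < n * k)%N -> fa (den Keep s) aO x = fa s aH (x %% k * n + x %/ k)%N &
    forall x, (x < k * d)%N -> fa (den Keep s) aO (n * k + x) = fa s aV x].
Proof.
move=> C acc; rewrite /Keep den_Seq; set s0 := den _ s.
have C0 : consts s0 by apply: consts_den.
have -> : den (IfF 12 13 (Reg (FAdd 13 12 0) ;; RecordU ;; RecordV) Skip) s0
    = den (Reg (FAdd 13 12 0) ;; RecordU ;; RecordV) s0.
  rewrite den_IfF ifT // /s0 den_IfI (ir7 C).
  case: ifP => [_|t0]; first by rewrite den_FAdd /= updE upd_ne // (fr0 C) addr0.
  by rewrite !fr_den //; case: acc => // E; rewrite E in t0.
rewrite 2!den_Seq; set s1 := den _ s0; set s2 := den RecordU s1.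
have C1 : consts s1 by apply: consts_den.
have C2 : consts s2 by apply: consts_den.
have [V1 V2] := RecordV_spec C2; split.
- rewrite fr_den // /s2 fr_den // /s1 den_FAdd /= updE (fr0 C0) addr0 /s0 fr_den //.
- by move=> x xlt; rewrite V2 // /s2 RecordU_spec // /s1 fa_den // /s0 fa_den.
- move=> x xlt; rewrite V1 // /s2 fa_den // /s1 fa_den // /s0 fa_den //.
Qed.

Lemma Keep_reject s : consts s -> fr s 13 < fr s 12 -> ir s 33 <> 0%N ->
  fr (den Keep s) 13 = fr s 13 /\ forall x, fa (den Keep s) aO x = fa s aO x.
Proof.
move=> C rej t0; rewrite /Keep den_Seq den_IfF den_IfI (ir7 C) leqn0.
rewrite (introF eqP t0) !fr_den // leNgt rej /=; split=> [|x].
  by rewrite !fr_den.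
by rewrite !fa_den.
Qed.

(** * The search over all choices of columns *)

Definition stored_U s : 'M[R]_(n, k) := \matrix_(i, l) fa s aO (i * k + l)%N.
Definition stored_V s : 'M[R]_(k, d) := \matrix_(l, j) fa s aO (n * k + (l * d + j))%N.

Lemma l1norm_columns (U : 'M[R]_(n, k)) (V : 'M[R]_(k, d)) :
  l1norm (U *m V - A) = \sum_j cnorm (col j A - \sum_l V l j *: col l U).
Proof.
rewrite /l1norm exchange_big; apply: eq_bigr => j _; apply: eq_bigr => i _.
rewrite !mxE summxE -normrN opprB; congr `|_ - _|; apply: eq_bigr => l _.
by rewrite !mxE mulrC.
Qed.

Lemma Search_spec s : consts s ->
  let s' := den SearchAll s in
  fr s' 13 = l1norm (stored_U s' *m stored_V s' - A) /\
  forall t (v : 'I_d -> 'cV[R]_n), (t < d ^ k)%N ->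
    (forall j, spanned k (fun l => col (dcol t l) A) (v j)) ->
    fr s' 13 <= 4 * \sum_j cnorm (col j A - v j).
Proof.
move=> C.
(* The guard [0 < t] is there because no pair is stored before the first choice. *)
pose Inv t s' := ((0 < t)%N -> fr s' 13 = l1norm (stored_U s' *m stored_V s' - A)) /\
  forall t' (v : 'I_d -> 'cV[R]_n), (t' < t)%N ->
    (forall j, spanned k (fun l => col (dcol t' l) A) (v j)) ->
    fr s' 13 <= 4 * \sum_j cnorm (col j A - v j).
suff [H1 H2] : Inv (d ^ k)%N (den SearchAll s).
  by split=> //; apply: H1; rewrite expn_gt0 d_gt0.
rewrite -(ir9 C); apply: (@for_inv _ Inv 33 9 _ s) => //.
move=> t s' lt_t xt S [I1 I2]; rewrite (ir9 C) in lt_t.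
have C' : consts s' by apply: consts_same S C.
rewrite 2!den_Seq; set s1 := den Basis s'; set s2 := den Solve s1; set s3 := den Keep s2.
have C1 : consts s1 by apply: consts_den.
have C2 : consts s2 by apply: consts_den.
have BI : basis_inv k (fun l => col (dcol t l) A) (fun l => vec s1 aH (l * n))
    (fun l => vec s1 aQ (l * n)) k.
  by have := @Basis_spec s' C'; rewrite xt; apply.
have [e [e1 e2 e3]] := Solve_spec C1 BI; rewrite -/s2 in e1 e2.
have new v : (forall j, spanned k (fun l => col (dcol t l) A) (v j)) ->
    fr s2 12 <= 4 * \sum_j cnorm (col j A - v j).
  move=> sv; rewrite e1 mulr_sumr; apply: ler_sum => j _; apply: e3.
  by apply: spanned_trans (sv j) => l lk; apply: (inv_a BI).
have i33 : ir s2 33 = t by rewrite /s2 ir_den // /s1 ir_den.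
have UV (x y : st R) : (forall i, fa x aO i = fa y aO i) ->
    stored_U x *m stored_V x = stored_U y *m stored_V y.
  by move=> E; congr (_ *m _); apply/matrixP => a b; rewrite !mxE E.
have Uinc (x : st R) : stored_U (incr 33 x) *m stored_V (incr 33 x) = stored_U x *m stored_V x.
  by apply: UV => i; rewrite fa_incr.
have [acc|/andP[rej t0]] : (fr s2 12 <= fr s2 13 \/ ir s2 33 = 0%N) \/
    (fr s2 13 < fr s2 12) && (t != 0%N).
  rewrite i33; have [->|t0] := eqVneq t 0%N; first by left; right.
  by case: leP => H; [left; left|right].
- have [K1 K2 K3] := Keep_accept C2 acc; rewrite -/s3 in K1 K2 K3.
  split=> [_|t' v t't sv]; rewrite fr_incr K1.
    rewrite Uinc e1 l1norm_columns; apply: eq_bigr => j _; rewrite e2.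
    congr (cnorm (_ - _)); apply: eq_bigr => l _; rewrite mxE K3; last first.
      by have := ltn_ord j; have := ltn_ord l; nia.
    congr (_ *: _); apply/matrixP => i i'; rewrite !mxE K2; last first.
      by have := ltn_ord i; have := ltn_ord l; nia.
    rewrite modnMDl modn_small // divnMDl // divn_small // addn0.
    by rewrite /s2 fa_den.
  move: t't; rewrite ltnS leq_eqVlt => /orP[/eqP E|lt]; first by apply: new; rewrite -E.
  apply: le_trans (I2 t' v lt sv); case: acc => [le|E].
    by apply: le_trans le _; rewrite /s2 fr_den // /s1 fr_den.
  by move: lt; rewrite -i33 E.
- have [] := Keep_reject C2 rej; first by rewrite i33; apply/eqP.
  rewrite -/s3 => K1 K2.
  have f13 : fr s2 13 = fr s' 13 by rewrite /s2 fr_den // /s1 fr_den.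
  split=> [_|t' v t't sv]; rewrite fr_incr K1.
    rewrite Uinc (UV s3 s') => [|i]; first by rewrite f13 I1 // lt0n.
    by rewrite K2 /s2 fa_den // /s1 fa_den.
  move: t't; rewrite ltnS leq_eqVlt => /orP[/eqP E|lt].
    by apply: le_trans (ltW rej) _; apply: new; rewrite -E.
  by rewrite f13; apply: I2 sv.
Qed.

(** Writing the output overwrites the input and parts of the arrays. It is safe in increasing order:
    entry [y] of [aO] lies at address [n d + 8 y + 7], beyond every address written before it is
    read. *)
Lemma Output_spec s x : consts s -> (x < n * k + k * d)%N ->
  fm (den Output s) x = fa s aO x.
Proof.
move=> C; pose Inv t s' := (forall x, (x < t)%N -> fm s' x = fa s aO x) /\
  forall x, (t <= x)%N -> fa s' aO x = fa s aO x.
suff [H _] : Inv (n * k + k * d)%N (den Output s) by move=> xlt; apply: H.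
rewrite -(ir12 C); apply: (@for_inv_wf _ Inv 20 12 _ s) => //.
move=> t s' lt_t xt si [I1 I2].
rewrite den_Seq den_Wr den_Ld; split=> y.
  rewrite ltnS fm_incr /= /upd /= -!/(fa s' _ _) xt => yt; case: eqP => [->|ne].
    exact: I2.
  by apply: I1; rewrite ltn_neqAle yt andbT; apply/eqP.
move=> ty; rewrite fa_incr // /fa /= /upd /= xt.
case: eqP => E; last by apply: I2; apply: ltnW.
by exfalso; move: E ty; clear; lia.
Qed.

(** The comparison is made with each [B] of rank at most [k] separately and with arbitrary slack, so
    that an infimum is enough; the slack is divided by 4 because the regression multiplies it by
    4. *)
Lemma Search_optimal s s' : consts s -> s' = den SearchAll s ->
  l1norm (stored_U s' *m stored_V s' - A) <= 4 * (k%:R + 1) * min_rank_err A k.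
Proof.
move=> C Es'; have [E best] := Search_spec C; rewrite -Es' in E best.
have c0 : 0 < 4 * (k%:R + 1) :> R by rewrite mulr_gt0 // ltr_wpDl.
rewrite -ler_pdivrMl //; apply: lb_le_inf.
  by exists (l1norm (0 - A)), 0 => //=; rewrite mxrank0.
move=> _ [B /= rB <-]; rewrite ler_pdivrMl //; apply/ler_addgt0Pr => e e0.
have e4 : 0 < e / 4 by rewrite divr_gt0.
have [f [X le_e]] := exists_col_subset A d_gt0 rB e4.
(* The good columns form one of the enumerated choices. *)
have [t tlt tf] := @exists_digits d k (fun l => f l) (fun l _ => ltn_ord (f l)).
rewrite -E; apply: le_trans (best t (fun j => \sum_(l < k) X l j *: col (f l) A) tlt _) _.
  move=> j; exists (X^~ j); apply: eq_bigr => l _; congr (_ *: col _ _).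
  by apply: val_inj; rewrite /= tf.
lra.
Qed.

(** * Initialisation of the constant registers *)

Lemma add_loop_spec i x y z s : wellformed (For i y (Reg (IAdd x x z))) ->
  x != i -> x != 4 -> z \notin [:: i; 4; x]%N ->
  ir (den (For i y (Reg (IAdd x x z))) s) x = (ir s x + ir s y * ir s z)%N.
Proof.
move=> wf xi x4; rewrite !inE !negb_or => /and3P[zi z4 zx].
pose Inv t s' := ir s' x = (ir s x + t * ir s z)%N.
apply: (@for_inv_wf _ Inv i y _ s) => //; first by rewrite /Inv ir_reset // mul0n addn0.
move=> t s' lt_t xt si; rewrite /Inv => I.
rewrite ir_incr ?inE ?negb_or ?xi // den_IAdd /= updE I si.
  by rewrite mulSn -addnA [(t * _ + _)%N]addnC.
by rewrite /= !inE !negb_or zi z4 zx.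
Qed.

Lemma InitBase_spec s : ir s 5 = 0%N ->
  [/\ ir (den InitBase s) 5 = (ir s 0 * ir s 1)%N, fr (den InitBase s) = fr s &
      fm (den InitBase s) = fm s].
Proof.
move=> s5; split; first by rewrite add_loop_spec // s5.
  by apply/funext => r; rewrite fr_den.
pose Inv (_ : nat) s' := fm s' = fm s.
apply: (@for_inv_wf _ Inv 20 0 _ s) => // t s' _ _ _; rewrite /Inv => I.
by rewrite fm_incr den_IAdd /= I.
Qed.

Lemma Power_spec x b s : x \in [:: 8; 9]%N -> b \in [:: 1; 6]%N -> ir s 7 = 0%N ->
  ir (den (Power x b) s) x = (ir s b ^ ir s 2)%N.
Proof.
move=> xin bin s7; rewrite /Power den_Seq; set s0 := den _ s.
have [x20 x21 x22 [x4 x7 x5 x2]] :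
    [/\ x != 20, x != 21, x != 22 & [/\ x != 4, x != 7, x != 5 & x != 2]]%N.
  by move: xin; rewrite !inE => /orP[] /eqP->.
have [b20 b21 b22 [b4 bx]] : [/\ b != 20, b != 21, b != 22 & b != 4 /\ b != x]%N.
  by move: xin bin; rewrite !inE => /orP[] /eqP-> /orP[] /eqP->.
have E0 r : r != x -> ir s0 r = ir s r by move=> rx; rewrite /s0 den_IConst /= upd_ne.
pose Inv t s' := ir s' x = (ir s b ^ t)%N.
set f := For _ _ _; suff : Inv (ir s0 2) (den f s0) by rewrite E0 // eq_sym.
have wf : wellformed f.
  by move: xin bin; rewrite /f !inE => /orP[] /eqP-> /orP[] /eqP->.
apply: (@for_inv_wf _ Inv 20 2 _ s0) => //.
  by rewrite /Inv ir_reset // /s0 den_IConst /= updE expn0.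
move=> t s' lt_t xt si; rewrite /Inv => I.
rewrite ir_incr ?inE ?negb_or ?x20 // 2!den_Seq den_IAdd /= updE.
rewrite add_loop_spec //; last 2 first.
- by move: bin; rewrite !inE => /orP[] /eqP->.
- by rewrite !inE !negb_or x22 x4 x21.
have e7 : ir s' 7 = 0%N.
  by rewrite si ?E0 1?eq_sym //; move: xin; rewrite !inE => /orP[] /eqP->.
have eb : ir s' b = ir s b.
  by rewrite si ?E0 // /= !inE !negb_or b20 b4 b21 b22 bx.
rewrite [ir (den (For _ _ _) _) 7]ir_den // !den_IConst /upd /= e7 addn0 add0n.
by rewrite (negbTE b21) (negbTE x21) eb I expnS.
Qed.

Definition start : st R := State (nth 0%N [:: n; d; k]) (fun=> 0) (write_mx A).

Lemma write_mxE (i : 'I_n) (j : 'I_d) : write_mx A (i * d + j)%N = A i j.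
Proof.
rewrite /write_mx (bigD1 i) //= (big_pred1 j) => [|j']; last first.
  by rewrite row_major_eq // eqxx /= eq_sym.
rewrite big1 ?addr0 // => i' ii'; rewrite big_pred0 // => j'.
by rewrite row_major_eq // val_eqE eq_sym (negbTE ii').
Qed.

Lemma InitSizes_spec s : ir s 7 = 0%N -> ir s 10 = 0%N -> ir s 11 = 0%N -> fr s 7 = 0 ->
  let s' := den InitSizes s in
  [/\ ir s' 10 = (ir s 0 * ir s 2)%N, ir s' 11 = (ir s 2 * ir s 1)%N,
      ir s' 12 = (ir s 0 * ir s 2 + ir s 2 * ir s 1)%N &
  [/\ ir s' 6 = (2 * 16 ^ (ir s 2).+1)%N, fr s' 6 = 16 ^+ (ir s 2).+1,
      fr s' 7 = 4 * (ir s 2)%:R & fr s' 14 = 1]].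
Proof.
move=> i7 i10 i11 f7; rewrite /InitSizes 10!den_Seq.
set s1 := den (For 20 0 _) s; set s2 := den (For 20 2 _) s1.
set s3 := den (Reg _) s2; set s4 := den (Reg (IConst 6 32)) s3.
set s5 := den (For 20 2 _) s4; set s6 := den (Reg _) s5; set s7 := den (Reg _) s6.
set s8 := den (For 20 2 _) s7; set s9 := den (Reg _) s8; set s10 := den (For 20 2 _) s9.
have E10 : ir s1 10 = (ir s 0 * ir s 2)%N by rewrite /s1 add_loop_spec // i10.
have E11 : ir s2 11 = (ir s 2 * ir s 1)%N.
  by rewrite /s2 add_loop_spec // !ir_den // i11.
have E12 : ir s3 12 = (ir s 0 * ir s 2 + ir s 2 * ir s 1)%N.
  by rewrite /s3 den_IAdd /= updE E11 /s2 ir_den // E10.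
have E2 : ir s4 2 = ir s 2 by rewrite /s4 ir_den // /s3 ir_den // /s2 ir_den // /s1 ir_den.
have E6 : ir s5 6 = (2 * 16 ^ (ir s 2).+1)%N.
  pose Inv t (s' : st R) := ir s' 6 = (2 * 16 ^ t.+1)%N.
  rewrite -E2; apply: (@for_inv _ Inv 20 2 _ s4) => //.
    by rewrite /Inv ir_reset // /s4 den_IConst /= updE.
  move=> t s' _ _ _; rewrite /Inv => I; rewrite ir_incr // 3!den_Seq !den_IAdd /upd /= I.
  by rewrite [(16 ^ t.+2)%N]expnS; lia.
have F6 : fr s8 6 = 16 ^+ (ir s 2).+1.
  have E2' : ir s7 2 = ir s 2 by rewrite /s7 ir_den // /s6 ir_den // /s5 ir_den.
  pose Inv t (s' : st R) := fr s' 6 = 16 ^+ t.+1 /\ fr s' 1 = 16.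
  suff [] : Inv (ir s7 2) (den (For 20 2 (Reg (FMul 6 6 1))) s7) by rewrite E2'.
  apply: (@for_inv _ Inv 20 2 _ s7) => //.
    by split; rewrite fr_reset /s7 den_FConst /upd //= /s6 den_FConst /= updE expr1.
  move=> t s' _ _ _ [I1 I2]; split; rewrite fr_incr den_FMul /upd //= I1 I2.
  by rewrite -exprSr.
have F7 : fr s10 7 = 4 * (ir s 2)%:R.
  have E2' : ir s9 2 = ir s 2.
    by rewrite /s9 ir_den // /s8 ir_den // /s7 ir_den // /s6 ir_den // /s5 ir_den.
  pose Inv t (s' : st R) := fr s' 7 = 4 * t%:R /\ fr s' 1 = 4.
  suff [] : Inv (ir s9 2) (den (For 20 2 (Reg (FAdd 7 7 1))) s9) by rewrite E2'.
  apply: (@for_inv _ Inv 20 2 _ s9) => //.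
    split; rewrite fr_reset /s9 ?den_FConst /= ?updE // upd_ne // mulr0.
    by rewrite /s8 fr_den // /s7 fr_den // /s6 fr_den // /s5 fr_den // /s4 fr_den // /s3 fr_den // /s2 fr_den // /s1 fr_den.
  move=> t s' _ _ _ [I1 I2]; split; rewrite fr_incr den_FAdd /upd //= I1 I2.
  by rewrite -[t.+1%:R]natr1 mulrDr mulr1.
split.
- rewrite ir_den // /s10 ir_den // /s9 ir_den // /s8 ir_den // /s7 ir_den // /s6 ir_den //.
  by rewrite /s5 ir_den // /s4 ir_den // /s3 ir_den // /s2 ir_den.
- rewrite ir_den // /s10 ir_den // /s9 ir_den // /s8 ir_den // /s7 ir_den // /s6 ir_den //.
  by rewrite /s5 ir_den // /s4 ir_den // /s3 ir_den.
- rewrite ir_den // /s10 ir_den // /s9 ir_den // /s8 ir_den // /s7 ir_den // /s6 ir_den //.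
  by rewrite /s5 ir_den // /s4 ir_den.
split.
- by rewrite ir_den // /s10 ir_den // /s9 ir_den // /s8 ir_den // /s7 ir_den // /s6 ir_den.
- by rewrite fr_den // /s10 fr_den // /s9 fr_den.
- by rewrite fr_den.
- by rewrite den_FConst /= updE.
Qed.

Lemma Setup_consts : consts (den (Power 8 6) (den Setup start)).
Proof.
rewrite /Setup 2!den_Seq.
have [B5 Bf Bm] : [/\ ir (den InitBase start) 5 = (n * d)%N,
    fr (den InitBase start) = (fun=> 0) & fm (den InitBase start) = write_mx A].
  exact: InitBase_spec.
set s1 := den InitBase start in B5 Bf Bm *.
have [e0 e1 e2] : [/\ ir s1 0 = n, ir s1 1 = d & ir s1 2 = k] by rewrite /s1 !ir_den.
have [||||] := @InitSizes_spec s1; try by [rewrite /s1 ir_den|rewrite Bf].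
set s2 := den InitSizes s1; rewrite e0 e1 e2 -/gridL.
move=> E10 E11 E12 [E6 F6 F7 F14].
set s3 := den (Power 9 1) s2; set s4 := den (Power 8 6) s3.
have [_ _ _ R2] := @same_den _ InitSizes s1 isT isT.
have [_ _ _ R3] := @same_den _ (Power 9 1) s2 isT isT.
have [_ _ _ R4] := @same_den _ (Power 8 6) s3 isT isT.
have e5 : ir s2 5 = (n * d)%N by rewrite /s2 ir_den.
have e5' : ir s3 5 = (n * d)%N by rewrite /s3 ir_den.
have P9 : ir s3 9 = (d ^ k)%N.
  by rewrite /s3 Power_spec // /s2 !ir_den.
have e6 : ir s3 6 = (2 * gridL)%N by rewrite /s3 ir_den.
have P8 : ir s4 8 = ((2 * gridL) ^ k)%N.
  by rewrite /s4 Power_spec // ?e6 // /s3 !ir_den // /s2 !ir_den.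
have L r : r \notin wri InitBase -> r \notin wri InitSizes -> r \notin wri (Power 9 1) ->
    r \notin wri (Power 8 6) -> ir s4 r = nth 0%N [:: n; d; k] r.
  by move=> *; rewrite /s4 ir_den // /s3 ir_den // /s2 ir_den // /s1 ir_den.
have L2 r : r \notin wri (Power 9 1) -> r \notin wri (Power 8 6) -> ir s4 r = ir s2 r.
  by move=> *; rewrite /s4 ir_den // /s3 ir_den.
have LF r : r \notin wrf (Power 9 1) -> r \notin wrf (Power 8 6) -> fr s4 r = fr s2 r.
  by move=> *; rewrite /s4 fr_den // /s3 fr_den.
split.
- by rewrite L.
- by rewrite L.
- by rewrite L.
- by rewrite L2.
- by rewrite L2.
- by rewrite L.
- exact: P8.
- by rewrite /s4 ir_den.
- by rewrite L2.
- by rewrite L2.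
- by rewrite L2.
- by rewrite LF // /s2 fr_den // Bf.
- by rewrite LF // F6 /gridL natrX.
- by rewrite LF.
- by rewrite LF.
- move=> i j; have lt := raw_lt i j.
  by rewrite R4 ?R3 ?R2 ?Bm ?write_mxE // ?e5' ?e5 ?B5.
Qed.

End Correctness.

(** * Running time *)

(** A product dominating every loop limit at once; the factor 2 is for the limit [n k + k d]. *)
Definition loop_bound (n d k : nat) : nat :=
  (2 * n * k * d ^ k * (2 * gridL k) ^ k)%N.

Lemma leq_loop_bound n d k : (0 < n)%N -> (0 < d)%N -> (0 < k)%N ->
  all (fun x => x <= loop_bound n d k)%N
    [:: n; d; k; n * d; 2 * gridL k; (2 * gridL k) ^ k; d ^ k; n * k; k * d;
        n * k + k * d]%N.
Proof.
move=> n0 d0 k0; rewrite /loop_bound.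
have g0 : (0 < 2 * gridL k)%N by rewrite muln_gt0 expn_gt0.
have dX : (d <= d ^ k)%N by rewrite -{1}(expn1 d) leq_pexp2l.
have gY : (2 * gridL k <= (2 * gridL k) ^ k)%N.
  by rewrite -{1}(expn1 (2 * gridL k)%N) leq_pexp2l.
have X0 : (0 < d ^ k)%N by rewrite expn_gt0 d0.
have Y0 : (0 < (2 * gridL k) ^ k)%N by rewrite expn_gt0 g0.
move: dX gY X0 Y0 g0; move: (d ^ k)%N ((2 * gridL k) ^ k)%N => X Y.
move: (2 * gridL k)%N => g dX gY X0 Y0 g0.
have nk : (0 < n * k)%N by rewrite muln_gt0 n0 k0.
have XY : (0 < X * Y)%N by rewrite muln_gt0 X0 Y0.
have mono a b : (a <= n * k -> b <= X * Y -> a * b <= 2 * n * k * X * Y)%N.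
  move=> ha hb; rewrite -!mulnA [(k * _)%N]mulnA [(n * _)%N]mulnA.
  by apply: leq_trans (leq_mul ha hb) _; rewrite -!mulnA leq_pmull.
have le1 a : (a <= n * k -> a <= 2 * n * k * X * Y)%N.
  by move=> ha; rewrite -[a]muln1; apply: mono.
have le2 b : (b <= X * Y -> b <= 2 * n * k * X * Y)%N.
  by move=> hb; rewrite -[b]mul1n; apply: mono.
have Xl : (X <= X * Y)%N by rewrite leq_pmulr.
have dl : (d <= X * Y)%N by apply: leq_trans Xl.
have Yl : (Y <= X * Y)%N by rewrite leq_pmull.
have nl : (n <= n * k)%N by rewrite leq_pmulr.
have kl : (k <= n * k)%N by rewrite leq_pmull.
rewrite /= !andbT; apply/and5P; split; [exact: le1|exact: le2|exact: le1|exact: mono|].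
apply/and5P; split; [by apply/le2/(leq_trans gY)|exact: le2|exact: le2|exact: le1|].
apply/andP; split; first exact: mono.
have -> : (2 * n * k * X * Y = n * k * (X * Y) + n * k * (X * Y))%N.
  by rewrite addnn -mul2n !mulnA.
by apply: leq_add; [rewrite leq_pmulr|apply: leq_mul].
Qed.

Section Total.
Variables (R : realType) (n d k : nat) (A : 'M[R]_(n, d)).
Hypotheses (n_gt0 : (0 < n)%N) (d_gt0 : (0 < d)%N) (k_gt0 : (0 < k)%N).

Lemma limits_within (c : com) (s : st R) (regs : seq nat) M :
  all (fun y => (y \notin wri c) && (y \in regs)) (limits c) ->
  {in regs, forall y, ir s y <= M}%N ->
  {in limits c, forall y, y \notin wri c /\ (ir s y <= M)%N}.
Proof. by move=> /allP H V y /H /andP[-> /V]. Qed.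

(** The program is cut where limit registers receive their values; in each piece the limits are
    constant and known at its start. *)
Lemma Prog_runs : runs_within (loop_bound n d k) Prog (start k A).
Proof.
have := leq_loop_bound n_gt0 d_gt0 k_gt0.
move: (loop_bound n d k) => M /= /and5P[Mn Md Mk Mnd /and5P[Mg MG MD Mnk /and3P[Mkd Mo _]]].
have C := Setup_consts A n_gt0 d_gt0 k_gt0.
apply: runs_within_seq.
  apply: runs_within_limits; first by vm_compute.
  apply: (@limits_within _ _ [:: 0; 1; 2]%N); first by vm_compute.
  by move=> y; rewrite !inE => /or3P[] /eqP->.
apply: runs_within_seq.
  apply: runs_within_limits; first by vm_compute.
  apply: (@limits_within _ _ [:: 2; 6]%N); first by vm_compute.
  move=> y; rewrite !inE => /orP[] /eqP->.
    by move: (ir2 C); rewrite ir_den // => ->.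
  by move: (ir6 C); rewrite ir_den // => ->.
apply: runs_within_limits; first by vm_compute.
apply: (@limits_within _ _ [:: 0; 1; 2; 6; 8; 9; 10; 11; 12]%N); first by vm_compute.
move=> y; rewrite !inE.
do 8?[case/orP => [/eqP->|]]; last move/eqP->.
all: by rewrite ?(ir0 C) ?(ir1 C) ?(ir2 C) ?(ir6 C) ?(ir8 C) ?(ir9 C) ?(ir10 C) ?(ir11 C) ?(ir12 C).
Qed.

Lemma run_halted P w t (c : config R) : halted P c -> run P w t c = c.
Proof. by move=> hc; elim: t => //= t ->; rewrite /step hc. Qed.

(** Halted configurations do not change, so any time above the bound gives the same result. *)
Lemma run_Prog w t : (time (loop_bound n d k) Prog <= t)%N ->
  run (compile 0 Prog) w t (init A k)
    = conf (csize Prog) (den Prog (start k A)) (fun=> 0%N) 0.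
Proof.
move=> le_t; have [|u le_u E] := @Prog_runs (compile 0 Prog) [::] [::] w (fun=> 0%N) 0%N.
  by rewrite cats0.
rewrite -(subnKC (leq_trans le_u le_t)) run_add [init A k]/(conf 0 (start k A) (fun=> 0%N) 0).
by rewrite E add0n run_halted // /halted size_compile leqnn.
Qed.

Lemma Prog_correct w t : (time (loop_bound n d k) Prog <= t)%N ->
  let c := run (compile 0 Prog) w t (init A k) in
  halted (compile 0 Prog) c /\
  l1norm (outU n k c *m outV n k d c - A) <= 4 * (k%:R + 1) * min_rank_err A k.
Proof.
move=> le_t c; rewrite /c run_Prog //; split; first by rewrite /halted size_compile.
have C := Setup_consts A n_gt0 d_gt0 k_gt0.
rewrite /Prog 3!den_Seq; set s1 := den (Power 8 6) _ in C *; set s2 := den SearchAll s1.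
have C2 : consts k A s2 by apply: consts_den.
have := @Search_optimal R n d k A n_gt0 d_gt0 k_gt0 s1 s2 C erefl.
congr (l1norm (_ *m _ - A) <= _); apply/matrixP => i j; rewrite !mxE /= (Output_spec C2) //.
  by rewrite add0n; have := ltn_ord i; have := ltn_ord j; nia.
by rewrite ltn_add2l; have := ltn_ord i; have := ltn_ord j; nia.
Qed.

End Total.

(** * Success probability and final bounds *)

Lemma coin_prob_true (R : realType) t (E : (nat -> bool) -> Prop) :
  (forall w, E w) -> coin_prob R t E = 1.
Proof.
move=> HE; rewrite /coin_prob (_ : #|_| = (2 ^ t)%N).
  by rewrite natrX divff // expf_neq0 // pnatr_eq0.
rewrite -card_bool -card_tuple; apply: eq_card => s; rewrite !inE.
exact/asboolP.
Qed.

(** In the [h]-th power, [k ^ h] is absorbed by [2 ^ (k h)], and the grid size contributes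
    [(4 k + 5) * (k h)] to the exponent of 2. *)
Lemma loop_bound_pow (R : realType) (K h n d k : nat) :
  (K * loop_bound n d k ^ h)%N%:R <=
    (K%:R *: 'X^h).[n%:R] * d%:R `^ (k * h)%:R
    * 2 `^ (h + k * h + (4 * k + 5) * (k * h))%:R :> R.
Proof.
rewrite hornerZ hornerXn !powR_mulrn ?ler0n // -!natrX -!natrM ler_nat.
rewrite /loop_bound /gridL.
have -> : (2 * 16 ^ k.+1 = 2 ^ (4 * k + 5))%N.
  by rewrite (_ : 16 = 2 ^ 4)%N // -expnM -expnS; congr (2 ^ _)%N; lia.
have kh : (k ^ h <= 2 ^ (k * h))%N.
  case: h => [|h']; first by rewrite muln0.
  by rewrite expnM leq_exp2r // ltnW // ltn_expl.
rewrite !expnMn -!expnM; move: ((4 * k + 5) * (k * h))%N (d ^ (k * h))%N => x y.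
rewrite [(2 ^ (h + k * h + x))%N]expnD [(2 ^ (h + k * h))%N]expnD.
have -> : (K * (2 ^ h * n ^ h * k ^ h * y * 2 ^ x)
    = K * n ^ h * y * (2 ^ h * k ^ h * 2 ^ x))%N by lia.
by rewrite leq_mul2l leq_mul2r leq_mul2l kh !orbT.
Qed.

Theorem theoremC7 (R : realType) :
  exists (P : program) (T : nat -> nat -> nat -> nat)
         (q : {poly R}) (e1 e2 alpha : nat -> R),
    [/\ softO e1 (fun k => k%:R),
        softO e2 (fun k => k%:R ^+ 2),
        softO alpha (fun k => k%:R) &
        forall n d k : nat, (1 <= n)%N -> (1 <= d)%N -> (1 <= k)%N ->
          (T n d k)%:R <= q.[n%:R] * d%:R `^ e1 k * 2 `^ e2 k /\
          forall A : 'M[R]_(n, d),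
            (forall w : nat -> bool, halted P (run P w (T n d k) (init A k))) /\
            9 / 10 <= coin_prob R (T n d k) (fun w =>
              let c := run P w (T n d k) (init A k) in
              l1norm (outU n k c *m outV n k d c - A)
                <= alpha k * min_rank_err A k)].
Proof.
pose h := depth Prog; pose K := weight Prog.
exists (compile 0 Prog), (fun n d k => (K * loop_bound n d k ^ h)%N), (K%:R *: 'X^h),
  (fun k => (k * h)%:R), (fun k => (h + k * h + (4 * k + 5) * (k * h))%:R),
  (fun k => 4 * (k%:R + 1)).
split.
- exists h%:R, 0%N => k _; rewrite expr0 mulr1 -natrM ler_nat.
  by rewrite mulnC.
(* 11 is the sum of the coefficients 1, 1, 4 and 5 of the exponent, each monomial being at most
   [h k ^ 2]. *)
- exists (11 * h)%:R, 0%N => k k1; rewrite expr0 mulr1 -natrX -natrM ler_nat.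
  clearbody h; nia.
- exists 8, 0%N => k k1; rewrite expr0 mulr1.
  have : 1 <= k%:R :> R by rewrite ler1n.
  lra.
move=> n d k n0 d0 k0; split; first exact: loop_bound_pow.
have tl : (time (loop_bound n d k) Prog <= K * loop_bound n d k ^ h)%N.
  apply: time_le; rewrite !muln_gt0 !expn_gt0 n0 d0 k0 muln_gt0 expn_gt0.
  by [].
move=> A; split=> [w|]; first by have [] := Prog_correct A n0 d0 k0 w tl.
rewrite coin_prob_true; first by rewrite ler_pdivrMr // mul1r ler_nat.
by move=> w; have [] := Prog_correct A n0 d0 k0 w tl.
Qed.
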